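(* Let $\vartheta_{\boldsymbol{P}}=(\vartheta,\boldsymbol{P})$ be a primitive, compatible and recognisable random substitution on a finite alphabet $\mathcal{A}$, with Perron--Frobenius eigenvalue $\lambda$, normalised right Perron--Frobenius eigenvector $(R_a)_{a\in\mathcal{A}}$ and frequency measure $\mu_{\boldsymbol{P}}$. Then $$\alpha_{\min}:=\lim_{q\to\infty}\frac{\tau_{\mu_{\boldsymbol{P}}}(q)}{q}=-\frac{1}{\lambda-1}\sum_{a\in\mathcal{A}}R_a\log\Big(\max_{s\in\vartheta(a)}\mathbb{P}[\vartheta_{\boldsymbol{P}}(a)=s]\Big),$$ $$\alpha_{\max}:=\lim_{q\to-\infty}\frac{\tau_{\mu_{\boldsymbol{P}}}(q)}{q}=-\frac{1}{\lambda-1}\sum_{a\in\mathcal{A}}R_a\log\Big(\min_{s\in\vartheta(a)}\mathbb{P}[\vartheta_{\boldsymbol{P}}(a)=s]\Big),$$ and for all $x\in X_\vartheta$, $$\alpha_{\min}\le\underline{\dim}_{\mathrm{loc}}(\mu_{\boldsymbol{P}},x)\le\overline{\dim}_{\mathrm{loc}}(\mu_{\boldsymbol{P}},x)\le\alpha_{\max}.$$ Moreover, $$\{\dim_{\mathrm{loc}}(\mu_{\boldsymbol{P}},x):x\in X_\vartheta\}=[\alpha_{\min},\alpha_{\max}],$$ where the set on the left ranges over those $x$ at which the local dimension exists.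
   Context: Random substitutions. Let $\mathcal{A}$ be a finite alphabet and $\mathcal{A}^+$ the set of non-empty finite words over $\mathcal{A}$; $|v|$ is the length of $v$ and $|v|_u$ the number of (possibly overlapping) occurrences of $u$ as a subword of $v$. A random substitution $\vartheta_{\boldsymbol{P}}=(\vartheta,\boldsymbol{P})$ consists of a set-valued substitution $\vartheta$ assigning to each letter $a$ a non-empty finite set $\vartheta(a)\subset\mathcal{A}^+$, together with, for each letter $a$, a probability vector on $\vartheta(a)$ with all entries strictly positive; $\mathbb{P}[\vartheta_{\boldsymbol{P}}(a)=s]$ denotes the probability of $s\in\vartheta(a)$. It acts on words by replacing each letter independently and concatenating; $\vartheta_{\boldsymbol{P}}^k(u)$ is the $k$-th step of the Markov chain on $\mathcal{A}^+$ started at $u$ (fresh independent choices at each step), and $\vartheta^k(u)$ is the set of words $v$ with $\mathbb{P}[\vartheta_{\boldsymbol{P}}^k(u)=v]>0$. The substitution matrix is $M_{b,a}=\mathbb{E}[|\vartheta_{\boldsymbol{P}}(a)|_b]$. $\vartheta_{\boldsymbol{P}}$ is primitive if some power of $M$ has all entries positive and the Perron--Frobenius eigenvalue $\lambda$ of $M$ satisfies $\lambda>1$. $\boldsymbol{R}=(R_a)_{a\in\mathcal{A}}$ is the positive right eigenvector, $M\boldsymbol{R}=\lambda\boldsymbol{R}$, with $\sum_aR_a=1$. $\vartheta_{\boldsymbol{P}}$ is compatible if for all $a,b\in\mathcal{A}$ and $u,v\in\vartheta(a)$, $|u|_b=|v|_b$; then $|\vartheta(a)|$ denotes the common length of the words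 in $\vartheta(a)$. A word is legal if it is a subword of some element of $\vartheta^k(a)$ for some $k\in\mathbb{N}$, $a\in\mathcal{A}$; $\mathcal{L}_\vartheta^n$ is the set of legal words of length $n$. The subshift $X_\vartheta\subset\mathcal{A}^{\mathbb{Z}}$ is the set of bi-infinite sequences all of whose finite subwords are legal, and $S$ is the left shift, $S(x)_i=x_{i+1}$. For $y\in X_\vartheta$, $\vartheta(y)$ is the set of bi-infinite concatenations $\cdots v_{-2}v_{-1}.v_0v_1\cdots$ with $v_j\in\vartheta(y_j)$ for all $j$, where $v_0$ starts at position $0$. A primitive compatible random substitution is recognisable if for every $x\in X_\vartheta$ there is a unique $y\in X_\vartheta$ and a unique integer $k\in\{0,\dots,|\vartheta(y_0)|-1\}$ with $S^{-k}(x)\in\vartheta(y)$. For legal $v$, $[v]=\{x\in X_\vartheta:x_i=v_i,\ 1\le i\le|v|\}$. The frequency measure $\mu_{\boldsymbol{P}}$ is the unique shift-invariant Borel probability measure on $X_\vartheta$ with $\mu_{\boldsymbol{P}}([v])=\lim_{k\to\infty}\mathbb{E}[|\vartheta_{\boldsymbol{P}}^k(a)|_v]/\mathbb{E}[|\vartheta_{\boldsymbol{P}}^k(a)|]$ for every legal $v$ (the limit exists and does not depend on $a\in\mathcal{A}$, by primitivity). For $q\in\mathbb{R}$, $\tau_{\mu_{\boldsymbol{P}}}(q)=\liminf_{n\to\infty}-\frac1n\log\sum_{u\in\mathcal{L}_\vartheta^n}\mu_{\boldsymbol{P}}([u])^q$. The lower and upper local dimensions $\underline{\dim}_{\mathrm{loc}}(\mu,x)$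 and $\overline{\dim}_{\mathrm{loc}}(\mu,x)$ are the limit inferior and limit superior as $n\to\infty$ of $-\frac{1}{2n+1}\log\mu(\{y\in X_\vartheta:y_j=x_j\text{ for }|j|\le n\})$; when they coincide the common value is $\dim_{\mathrm{loc}}(\mu,x)$. *)

(* Defs.v *)
From HB Require Import structures.
From mathcomp Require Import all_boot all_order all_algebra finmap complex.
From mathcomp Require Import all_classical all_reals all_analysis.

Set Implicit Arguments.
Unset Strict Implicit.
Unset Printing Implicit Defensive.

Import Order.TTheory GRing.Theory Num.Theory.
Import numFieldNormedType.Exports.

Local Open Scope classical_set_scope.
Local Open Scope ring_scope.

(* Finite, non-empty alphabets.  The base letter, required by the library for
   the carrier of a measurable type, plays no other role; non-emptiness is
   automatic here, as a 0 x 0 matrix has no eigenvalue. *)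
#[short(type="alphabetType")]
HB.structure Definition Alphabet := {A of Finite A & Pointed A}.

(* [rs_prob P a s] is the probability that the letter a is replaced by s. *)
Record random_substitution (R : realType) (A : alphabetType) := RandomSubst {
  rs_img : A -> {fset seq A};
  rs_prob : A -> seq A -> R;
  rs_img_nonempty : forall a, rs_img a != fset0;
  rs_word_nonempty : forall a s, s \in rs_img a -> s != [::];
  rs_prob_gt0 : forall a s, s \in rs_img a -> 0 < rs_prob a s;
  rs_prob_out : forall a s, s \notin rs_img a -> rs_prob a s = 0;
  rs_prob_sum : forall a, \sum_(s <- rs_img a) rs_prob a s = 1
}.

Section RandomSubstitution.
Context (R : realType) (A : alphabetType) (P : random_substitution R A).

(* A probability law on words is represented by a finite list of pairs
   (weight, word) in which a word may occur several times: its probability is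
   the sum of the weights it carries. *)
Definition word_law := seq (R * seq A).

Definition law_prob (l : word_law) (v : seq A) : R :=
  \sum_(w <- l | w.2 == v) w.1.

Definition law_mean (l : word_law) (f : seq A -> nat) : R :=
  \sum_(w <- l) w.1 * (f w.2)%:R.

(* Law of the image of u: letters are replaced independently. *)
Fixpoint subst_law (u : seq A) : word_law :=
  if u is a :: u' then
    [seq (rs_prob P a s * w.1, s ++ w.2) | s <- rs_img P a, w <- subst_law u']
  else [:: (1, [::])].

(* Law of the k-th step of the Markov chain started at u. *)
Fixpoint iter_law (k : nat) (u : seq A) : word_law :=
  if k is k'.+1 then
    [seq (w.1 * w'.1, w'.2) | w <- iter_law k' u, w' <- subst_law w.2]
  else [:: (1, u)].

(* Number of, possibly overlapping, occurrences of u in v. *)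
Definition occ (u v : seq A) : nat :=
  count (fun i => prefix u (drop i v)) (iota 0 (size v).+1).

(* Rows and columns are indexed by the letters through [enum_val]. *)
Definition subst_matrix : 'M[R]_#|A| :=
  \matrix_(i, j) law_mean (iter_law 1 [:: enum_val j]) (occ [:: enum_val i]).

(* The eigenvalue of largest modulus, among all complex eigenvalues. *)
Definition PF_eigenvalue n (M : 'M[R]_n) (lam : R) : Prop :=
  eigenvalue M lam /\
  forall z : R[i], eigenvalue (map_mx (real_complex R) M) z ->
    `|z| <= lam%:C%C.

Definition PF_right_eigenvector (lam : R) (r : A -> R) : Prop :=
  let r_col := \col_i r (enum_val i) in
  [/\ forall a, 0 < r a, \sum_a r a = 1 &
      subst_matrix *m r_col = lam *: r_col].

Definition primitive : Prop :=
  (exists k : nat, forall i j, 0 < (subst_matrix ^+ k) i j) /\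
  (exists2 lam : R, PF_eigenvalue subst_matrix lam & 1 < lam).

Definition compatible : Prop :=
  forall (a b : A) (u v : seq A), u \in rs_img P a -> v \in rs_img P a ->
    occ [:: b] u = occ [:: b] v.

(* The common length of the words in the image of a, for a compatible P. *)
Definition img_size (a : A) : nat := \max_(s <- rs_img P a) size s.

Definition legal (v : seq A) : Prop :=
  exists (k : nat) (a : A) (w : seq A),
    0 < law_prob (iter_law k [:: a]) w /\ infix v w.

(* The word x_i x_(i+1) ... x_(i+n-1). *)
Definition subword (x : int -> A) (i : int) (n : nat) : seq A :=
  mkseq (fun j => x (i + j%:Z)) n.

Definition subshift : set (int -> A) :=
  [set x | forall (i : int) (n : nat), legal (subword x i n)].

Definition shift (x : int -> A) : int -> A := fun i => x (i + 1).

(* S^(-k) *)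
Definition shift_back (k : nat) (x : int -> A) : int -> A :=
  fun i => x (i - k%:Z).

(* Bi-infinite concatenations ... v_(-1) . v_0 v_1 ... with v_j in the image of
   y_j: the block v_j occupies the positions c_j, ..., c_(j+1) - 1. *)
Definition subst_seq (y : int -> A) : set (int -> A) :=
  [set z | exists (v : int -> seq A) (c : int -> int),
    [/\ forall j, v j \in rs_img P (y j), c 0 = 0,
        forall j, c (j + 1) = c j + (size (v j))%:Z &
        forall j, subword z (c j) (size (v j)) = v j]].

Definition recognisable : Prop :=
  forall x, subshift x ->
    exists! yk : (int -> A) * nat,
      [/\ subshift yk.1, (yk.2 < img_size (yk.1 0))%N &
          subst_seq yk.1 (shift_back yk.2 x)].

(* Borel sigma-algebra of the product of discrete topologies. *)
Definition config_open : set (set (int -> A)) :=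
  @open (prod_topology (fun _ : int => discrete_topology A)).

Definition config : measurableType (sigma_display config_open) :=
  g_sigma_algebraType config_open.

Definition cylinder (v : seq A) : set (int -> A) :=
  [set x | subshift x /\ subword x 1 (size v) = v].

(* Measures on the subshift are measures on all configurations which give full
   mass to the subshift. *)
Definition frequency_measure (mu : probability config R) : Prop :=
  [/\ mu subshift = 1%E,
      forall B : set config, measurable B -> mu (shift @^-1` B) = mu B &
      forall (v : seq A) (a : A), legal v ->
        (law_mean (iter_law k [:: a]) (occ v) /
         law_mean (iter_law k [:: a]) size)%:E @[k --> \oo]
          --> mu (cylinder v)].

Section Multifractal.
Context (mu : probability config R).
Local Open Scope ereal_scope.

Definition tau (q : R) : \bar R :=
  limn_einf (fun n : nat => - ((n%:R : R)^-1)%:E *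
    lne (\sum_(u : n.-tuple A | `[< legal u >]) poweR (mu (cylinder u)) q)).

Definition central_cylinder (x : int -> A) (n : nat) : set (int -> A) :=
  [set y | subshift y /\ forall j : int, (`|j| <= n)%N -> y j = x j].

Definition local_dim_seq (x : int -> A) (n : nat) : \bar R :=
  - ((n.*2.+1%:R : R)^-1)%:E * lne (mu (central_cylinder x n)).

Definition lower_local_dim (x : int -> A) : \bar R :=
  limn_einf (local_dim_seq x).

Definition upper_local_dim (x : int -> A) : \bar R :=
  limn_esup (local_dim_seq x).

Definition has_local_dim (x : int -> A) (d : \bar R) : Prop :=
  lower_local_dim x = d /\ upper_local_dim x = d.

End Multifractal.

(* All the values lie in ]0, 1], so neither 0 nor 1 affects the extremum. *)
Definition max_prob (a : A) : R :=
  \big[Num.max/0]_(s <- rs_img P a) rs_prob P a s.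

Definition min_prob (a : A) : R :=
  \big[Num.min/1]_(s <- rs_img P a) rs_prob P a s.

End RandomSubstitution.

(* Main.v *)
(* Write I(u) = - log mu([u]).  Counting occurrences in the words theta^(k+1)(a)
   gives mu([u]) >= P[theta(v) = s] mu([v]) / lam whenever u lies inside the
   image s of v.  By compactness recognisability is local: a long word u
   determines, up to a bounded margin, the word v and the blocks s from which it
   comes, and then the reverse inequality holds.  Hence
     I(u) = I(v) - log P[theta(v) = s] + O(1),
   where |u| = lam |v| + o(|u|) because letter frequencies are uniform in legal
   words.  If the blocks are chosen so that a letter a costs h(a) on average, the
   middle term is |v| L + o(|v|) with L = sum_a R_a h(a), and iterating over the
   levels yields I(u) = |u| L / (lam - 1) + o(|u|).  The costs - log max and
   - log min bound all choices, which gives alpha_min and alpha_max; letting h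
   interpolate between them and choosing the blocks greedily at every level
   produces, in the limit, points with any local dimension in between. *)

Require Import Defs.
From HB Require Import structures.
From mathcomp Require Import all_boot all_order all_algebra finmap complex.
From mathcomp Require Import all_classical all_reals all_analysis.
From mathcomp Require Import ring lra zify.

Set Implicit Arguments.
Unset Strict Implicit.
Unset Printing Implicit Defensive.

Import Order.TTheory GRing.Theory Num.Theory.
Import numFieldNormedType.Exports.

Local Open Scope classical_set_scope.
Local Open Scope ring_scope.

(** * Cylinders and their measures *)

(** Frequencies are given only as limits of expected counts, so the work is done on decodings, where
    the letters and the blocks put in their place stay visible. An occurrence of [src e] is decoded
    as [e] with probability [pr P e]; comparing the occurrences of [u] with those of [e] before
    passing to the limit yields inequalities between frequencies. One direction only asks for some
    decoding whose image covers [u]. The other asks that no occurrence of [u] escapes [e], and this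
    is where recognisability enters. A word of length [n] passes through about [log n] levels, so
    the bounded errors of the levels must not simply be added. The error is stated as a slope [eps]
    plus a constant: the slope contracts by [lam^-1] at each level, and the room thus gained absorbs
    the new errors, so that the constant never changes. No exact formula for [tau] is sought. The
    number of words contributes at most [ln #|A|], which disappears after division by [q], and
    extremal points give the matching bound. The compactness arguments take limits along an
    ultrafilter on the integers instead of extracting subsequences. *)

Section ConfigurationSpace.
Context (R : realType) (A : alphabetType) (P : random_substitution R A).

Definition word_at (i : int) (w : seq A) : set (config A) :=
  [set x : int -> A | subword x i (size w) = w].

Lemma measurable_letter_at (i : int) (a : A) :
  measurable ([set x : int -> A | x i = a] : set (config A)).
Proof.
apply: sub_sigma_algebra.
have c := iffLR (@continuousP (prod_topology (fun _ : int =>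
  discrete_topology A))
    (discrete_topology A) (fun x => x i))
  (@proj_continuous int (fun _ => discrete_topology A) i).
exact: (c [set a] (discrete_open _)).
Qed.

Lemma subwordS (x : int -> A) i n :
  subword x i n.+1 = x i :: subword x (i + 1) n.
Proof.
rewrite /subword /mkseq /= addr0; congr (_ :: _).
rewrite -[1%N]/(1 + 0)%N iotaDl -map_comp; apply: eq_map => j /=.
by rewrite PoszD addrA.
Qed.

Lemma size_subword (x : int -> A) i n : size (subword x i n) = n.
Proof. exact: size_mkseq. Qed.

Lemma nth_subword (x : int -> A) a0 i n j :
  (j < n)%N -> nth a0 (subword x i n) j = x (i + j%:Z).
Proof. by move=> jn; rewrite nth_mkseq. Qed.

Lemma measurable_word_at (i : int) (w : seq A) : measurable (word_at i w).
Proof.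
elim: w i => [|a w IH] i.
  rewrite (_ : word_at i [::] = setT); first exact: measurableT.
  by apply/seteqP; split.
rewrite (_ : word_at i (a :: w) =
  ([set x : int -> A | x i = a] : set (config A)) `&` word_at (i + 1) w).
  by apply: measurableI => //; apply: measurable_letter_at.
apply/seteqP; split=> x; rewrite /word_at /= subwordS.
  by move=> [-> ->].
by move=> [-> ->].
Qed.

Lemma measurable_subshift : measurable (subshift P : set (config A)).
Proof.
rewrite (_ : subshift P = ~` \bigcup_(p : int * seq A)
    if `[< legal P p.2 >] then set0 else word_at p.1 p.2).
  apply/measurableC/countable_bigcupT_measurable => // p.
  by case: ifP => _; [exact: measurable0|exact: measurable_word_at].
apply/seteqP; split=> x /= xX.
  move=> [[i w] _ /=]; case: ifPn => // /asboolPn nl xw; apply: nl.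
  by rewrite -xw; apply: xX.
move=> i n; apply: contrapT => nl; apply: xX.
exists (i, subword x i n) => //=; rewrite asboolF//.
by rewrite /word_at /= size_subword.
Qed.

Definition cylinder_at (i : int) (w : seq A) : set (config A) :=
  (subshift P : set (config A)) `&` word_at i w.

Lemma measurable_cylinder_at i w : measurable (cylinder_at i w).
Proof.
by apply: measurableI; [exact: measurable_subshift|exact: measurable_word_at].
Qed.

Lemma subword_shift (x : int -> A) i n :
  subword (Defs.shift x) i n = subword x (i + 1) n.
Proof. by apply: eq_map => j; rewrite /Defs.shift addrAC. Qed.

Lemma subshift_shift (x : int ->
  A) : subshift P (Defs.shift x) <-> subshift P x.
Proof.
split=> xX i n; last by rewrite subword_shift.
by have := xX (i - 1) n; rewrite subword_shift subrK.
Qed.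

Lemma shift_cylinder_at i w :
  @Defs.shift A @^-1` cylinder_at i w = cylinder_at (i + 1) w.
Proof.
apply/seteqP; split=> x [xX xw]; split.
- exact/subshift_shift.
- by rewrite /word_at /= -subword_shift.
- exact/subshift_shift.
- by rewrite /word_at /= subword_shift.
Qed.

Context (mu : probability (config A) R).
Hypothesis freq : frequency_measure P mu.

Lemma mu_cylinder_at i w : mu (cylinder_at i w) = mu (cylinder P w).
Proof.
have [_ inv _] := freq.
have S j : mu (cylinder_at (j + 1) w) = mu (cylinder_at j w).
  by rewrite -shift_cylinder_at inv//; apply: measurable_cylinder_at.
have up n : mu (cylinder_at (1 + n%:Z) w) = mu (cylinder_at 1 w).
  elim: n => [|n IH]; first by rewrite addr0.
  by rewrite -IH -(S (1 + n%:Z)); congr (mu (cylinder_at _ w)); lia.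
have down n : mu (cylinder_at (1 - n%:Z) w) = mu (cylinder_at 1 w).
  elim: n => [|n IH]; first by rewrite subr0.
  by rewrite -IH -(S (1 - n.+1%:Z)); congr (mu (cylinder_at _ w)); lia.
have [le|lt] := lerP 1 i.
  by rewrite (_ : i = 1 + `|i - 1|%N%:Z) ?up//; lia.
by rewrite (_ : i = 1 - `|1 - i|%N%:Z) ?down//; lia.
Qed.

Lemma central_cylinderE (x : int -> A) n :
  central_cylinder P x n =
  cylinder_at (- n%:Z) (subword x (- n%:Z) n.*2.+1).
Proof.
apply/seteqP; split=> y [yX yx]; split=> //.
  rewrite /word_at /mkset size_subword; apply/eq_in_map => j.
  rewrite mem_iota /= add0n => jn; apply: yx; lia.
move=> j jn; move: yx; rewrite /word_at /mkset size_subword.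
move=> /(congr1 (fun s => nth point s (absz (j + n%:Z)))).
rewrite !nth_subword; [|lia|lia].
by rewrite (_ : - n%:Z + (absz (j + n%:Z))%:Z = j)//; lia.
Qed.

Definition freq_of (w : seq A) : R := fine (mu (cylinder P w)).

Lemma freq_ofE w : mu (cylinder P w) = (freq_of w)%:E.
Proof.
rewrite fineK// fin_num_measure//; exact: measurable_cylinder_at.
Qed.

Lemma mu_central_cylinder (x : int -> A) n :
  mu (central_cylinder P x n) = (freq_of (subword x (- n%:Z) n.*2.+1))%:E.
Proof. by rewrite central_cylinderE mu_cylinder_at freq_ofE. Qed.

Lemma freq_cvg v a : legal P v ->
  (law_mean (iter_law P k [:: a]) (occ v) /
   law_mean (iter_law P k [:: a]) size) @[k --> \oo] --> freq_of v.
Proof.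
have [_ _ lim] := freq; move=> /(lim _ a); rewrite freq_ofE.
by move=> /fine_cvgP[].
Qed.

End ConfigurationSpace.
(** * Occurrences and decodings *)

(** This is [occ] over any [eqType], so that occurrences of a decoding inside a decoding can be
    counted too. *)
Definition nocc (T : eqType) (u v : seq T) : nat :=
  count (fun i => prefix u (drop i v)) (iota 0 (size v).+1).

Lemma nocc_cons (T : eqType) (u : seq T) x v :
  nocc u (x :: v) = (prefix u (x :: v) + nocc u v)%N.
Proof.
rewrite /nocc.
have -> : iota 0 (size (x :: v)).+1 = 0%N :: map S (iota 0 (size v).+1).
  by rewrite -[map S _]/(map (addn 1) _) -iotaDl.
by rewrite [count _ (_ :: _)]/= count_map.
Qed.

Lemma nocc_nil (T : eqType) (u : seq T) : nocc u [::] = (u == [::]).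
Proof. by case: u. Qed.

Lemma nocc1 (T : eqType) (x : T) v : nocc [:: x] v = count_mem x v.
Proof.
elim: v => [|y v IH]; first by rewrite nocc_nil.
by rewrite nocc_cons IH /= prefix0s andbT eq_sym.
Qed.

Definition positions (T : eqType) (u v : seq T) : seq nat :=
  [seq i <- iota 0 (size v).+1 | prefix u (drop i v)].

Lemma size_positions (T : eqType) (u v : seq T) :
  size (positions u v) = nocc u v.
Proof. by rewrite size_filter. Qed.

Lemma mem_positions (T : eqType) (u v : seq T) i :
  u != [::] -> (i \in positions u v) = prefix u (drop i v).
Proof.
move=> u0; rewrite mem_filter mem_iota /= add0n ltnS.
have [|lt] := leqP i (size v); first by rewrite andbT.
by rewrite drop_oversize ?prefixs0 ?(negPf u0) // ltnW.
Qed.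

Lemma positions_uniq (T : eqType) (u v : seq T) : uniq (positions u v).
Proof. by rewrite filter_uniq ?iota_uniq. Qed.

Lemma prefix_lt_size (T : eqType) (u v : seq T) i :
  u != [::] -> prefix u (drop i v) -> (i < size v)%N.
Proof.
move=> u0; case: (ltnP i (size v)) => // le.
by rewrite drop_oversize // prefixs0 (negPf u0).
Qed.

Section Decodings.
Context (R : realType) (A : alphabetType) (P : random_substitution R A).

(* A decoding of a word lists the letters of a preimage together with the
   blocks which replace them. *)
Local Notation decoding := (seq (A * seq A)).

Definition valid (d : decoding) := all (fun p => p.2 \in rs_img P p.1) d.
Definition src (d : decoding) : seq A := unzip1 d.
Definition img (d : decoding) : seq A := flatten (unzip2 d).
Definition pr (d : decoding) : R := \prod_(p <- d) rs_prob P p.1 p.2.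

(** Different choices of blocks may give the same image; they stay distinct here, and [subst_law] is
    the push-forward under [img]. *)
Fixpoint decodings (w : seq A) : seq decoding :=
  if w is a :: w' then
    [seq (a, s) :: d | s <- rs_img P a, d <- decodings w']
  else [:: [::]].

Lemma occE (u v : seq A) : occ u v = nocc u v. Proof. by []. Qed.

Lemma size_src d : size (src d) = size d. Proof. exact: size_map. Qed.

Lemma img_cat d1 d2 : img (d1 ++ d2) = img d1 ++ img d2.
Proof. by rewrite /img /unzip2 map_cat flatten_cat. Qed.

Lemma src_cat d1 d2 : src (d1 ++ d2) = src d1 ++ src d2.
Proof. exact: map_cat. Qed.

Lemma valid_cat d1 d2 : valid (d1 ++ d2) = valid d1 && valid d2.
Proof. exact: all_cat. Qed.

Lemma valid_infix e d : infix e d -> valid d -> valid e.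
Proof.
by move=> /infixP[x [y ->]]; rewrite !valid_cat => /andP[_ /andP[]].
Qed.

Lemma src_infix (e d : decoding) : infix e d -> infix (src e) (src d).
Proof.
move=> /infixP[x [y ->]]; rewrite !src_cat.
by apply/infixP; exists (src x), (src y).
Qed.

Lemma pr_gt0 d : valid d -> 0 < pr d.
Proof.
rewrite /pr; elim: d => [|p d IH] /=; first by rewrite big_nil.
by move=> /andP[p1 p2]; rewrite big_cons mulr_gt0 ?IH// (rs_prob_gt0 p1).
Qed.

Lemma mem_decodings w d : (d \in decodings w) = valid d && (src d == w).
Proof.
elim: w d => [|a w IH] d /=.
  by rewrite mem_seq1; case: d => //= p d; rewrite andbF.
apply/allpairsP/idP => [[[s d'] /= [s_in]]|].
  by rewrite IH => /andP[vd' /eqP <-] -> /=; rewrite s_in vd' /= eqxx.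
case: d => [|[b s] d] //= /andP[/andP[s_in vd] /eqP[ba dw]].
exists (s, d); split; rewrite /= ?IH ?vd ?dw ?eqxx// -?ba//.
Qed.

Lemma subst_lawE w : subst_law P w = [seq (pr d, img d) | d <- decodings w].
Proof.
elim: w => [|a w IH] /=; first by rewrite /pr big_nil.
rewrite IH map_allpairs allpairs_mapr.
by apply: eq_allpairs => // s d; rewrite /pr big_cons.
Qed.

Lemma law_mean_subst w (F : seq A -> nat) :
  law_mean (subst_law P w) F = \sum_(d <- decodings w) pr d * (F (img d))%:R.
Proof. by rewrite /law_mean subst_lawE big_map. Qed.

Lemma big_decodings_cons (F : decoding -> R) a w :
  \sum_(d <- decodings (a :: w)) F d =
  \sum_(s <- rs_img P a) \sum_(d <- decodings w) F ((a, s) :: d).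
Proof. by rewrite /= big_allpairs_dep. Qed.

Lemma sum_pr w : \sum_(d <- decodings w) pr d = 1.
Proof.
elim: w => [|a w IH]; first by rewrite big_seq1 /pr big_nil.
rewrite big_decodings_cons -(rs_prob_sum P a); apply: eq_bigr => s _.
rewrite -[RHS]mulr1 -IH mulr_sumr; apply: eq_bigr => d _.
by rewrite /pr big_cons.
Qed.

(** By independence the blocks prescribed by [e] contribute the product [pr e], and the free blocks
    after them sum to 1. *)
Lemma mean_prefix e w : valid e ->
  \sum_(d <- decodings w) pr d * (prefix e d)%:R =
  (prefix (src e) w)%:R * pr e.
Proof.
elim: w e => [|a w IH] [|[b t] e] /=.
- by rewrite !big_seq1 /pr !big_nil mul1r.
- by rewrite big_seq1 mulr0 mul0r.
- move=> _; rewrite -/(decodings (a :: w)) [pr [::]]/pr big_nil mulr1.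
  by apply: etrans (sum_pr (a :: w)); apply: eq_bigr => d _;
    rewrite prefix0s mulr1.
move=> /andP[t_in ve]; rewrite -/(decodings (a :: w)) big_decodings_cons.
under eq_bigr => s _ do under eq_bigr => d _ do
  rewrite /= xpair_eqE /pr big_cons /= -/(pr d) -mulnb natrM mulrACA.
under eq_bigr => s _ do rewrite -mulr_sumr (IH e ve).
rewrite -mulr_suml {2}/pr big_cons /= -/(pr e).
have [<-|nba] := eqVneq b a; last first.
  by rewrite big1_seq ?mul0r// => s _; rewrite /= mulr0.
rewrite /= mulrCA; congr (_ * (_ * _)).
rewrite (bigD1_seq t) ?fset_uniq//= eqxx mulr1 big1 ?addr0// => s.
by rewrite eq_sym => /negPf ->; rewrite mulr0.
Qed.

(* The letters of w are replaced independently, so an occurrence of src e in w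
   is decoded as e with probability pr e. *)
Lemma mean_nocc e w : valid e -> e != [::] ->
  \sum_(d <- decodings w) pr d * (nocc e d)%:R = (occ (src e) w)%:R * pr e.
Proof.
move=> ve e0; have s0 : src e != [::] by case: e e0 {ve}.
elim: w => [|a w IH].
  by rewrite big_seq1 !nocc_nil occE nocc_nil (negPf e0) (negPf s0) mulr0 mul0r.
rewrite occE nocc_cons natrD mulrDl -mean_prefix// -IH.
(* Occurrences that start after the first letter do not depend on its block [s], so they may be
   averaged over [s]. *)
have sum1 x : x = \sum_(s <- rs_img P a) rs_prob P a s * x.
  by rewrite -mulr_suml rs_prob_sum mul1r.
rewrite !big_decodings_cons [X in _ = _ + X]sum1 -big_split.
apply: eq_bigr => s _; rewrite mulr_sumr -big_split; apply: eq_bigr => d _.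
by rewrite nocc_cons natrD mulrDr [in X in _ + X]/pr big_cons -mulrA.
Qed.

Lemma law_mean_iterS k u (F : seq A -> nat) :
  law_mean (iter_law P k.+1 u) F =
  \sum_(w <- iter_law P k u) w.1 * law_mean (subst_law P w.2) F.
Proof.
rewrite /law_mean /= big_allpairs_dep; apply: eq_bigr => w _.
by rewrite mulr_sumr; apply: eq_bigr => w' _; rewrite mulrA.
Qed.

(** All listed weights are positive, so membership in the list is the same as positive probability;
    this turns legality into pure combinatorics. *)
Definition reach k u w := w \in [seq z.2 | z <- iter_law P k u].

Lemma iter_law_gt0 k u z : z \in iter_law P k u -> 0 < z.1.
Proof.
elim: k z => [|k IH] z /=; first by rewrite mem_seq1 => /eqP ->.
move=> /allpairsPdep[w [w' [win]]]; rewrite subst_lawE.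
move=> /mapP[d]; rewrite mem_decodings => /andP[vd _] -> -> /=.
by rewrite mulr_gt0 ?IH ?pr_gt0.
Qed.

Lemma reachP k u w : reach k u w <-> 0 < law_prob (iter_law P k u) w.
Proof.
rewrite /law_prob; split=> [/mapP[z z_in ->]|].
  rewrite big_seq_cond (perm_big _ (perm_to_rem z_in)) /= big_cons z_in eqxx /=.
  rewrite ltr_pwDl ?(iter_law_gt0 z_in)// sumr_ge0// => y /andP[/iter_law_gt0].
  by move/ltW.
apply: contraLR => nw; rewrite -leNgt big1_seq// => z /andP[/eqP zw z_in].
by move: nw; rewrite /reach -zw map_f.
Qed.

Lemma reach0 u w : reach 0 u w = (w == u).
Proof. by rewrite /reach mem_seq1. Qed.

Lemma reachSP k u w :
  reach k.+1 u w <-> exists d, [/\ valid d, reach k u (src d) & img d = w].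
Proof.
rewrite /reach /=; split.
  move=> /mapP[z /allpairsPdep[y [y' [yin]]]]; rewrite subst_lawE.
  move=> /mapP[d]; rewrite mem_decodings => /andP[vd /eqP dy] -> -> ->.
  by exists d; split => //; rewrite dy; apply: map_f.
move=> [d [vd /mapP[y yin yd] <-]].
apply/mapP; exists (y.1 * pr d, img d) => //.
apply/allpairsPdep; exists y, (pr d, img d); split => //.
by rewrite subst_lawE; apply/map_f; rewrite mem_decodings vd yd /=.
Qed.

(** Grading legality by the number of substitution steps supplies the parameter for induction by
    desubstitution. *)
Definition level k v := exists a w, reach k [:: a] w /\ infix v w.

Lemma legalP v : legal P v <-> exists k, level k v.
Proof.
split=> [[k [a [w [/reachP rw vw]]]]|[k [a [w [/reachP rw vw]]]]].
  by exists k, a, w.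
by exists k, a, w.
Qed.

Lemma level_legal k v : level k v -> legal P v.
Proof. by move=> kv; apply/legalP; exists k. Qed.

Lemma level_infix k u v : infix u v -> level k v -> level k u.
Proof.
by move=> uv [a [w [aw vw]]]; exists a, w; split=> //; apply: infix_trans vw.
Qed.

Lemma legal_infix u v : infix u v -> legal P v -> legal P u.
Proof. by move=> uv /legalP[k kv]; apply/legalP; exists k;
  apply: level_infix kv. Qed.

Lemma levelSP k v : level k.+1 v ->
  exists d, [/\ valid d, level k (src d) & infix v (img d)].
Proof.
move=> [a [w [/reachSP[d [vd rd <-]] vw]]]; exists d; split=> //.
by exists a, (src d); split=> //; apply: infix_refl.
Qed.

Lemma reach_legal k a w : reach k [:: a] w -> legal P w.
Proof. by move=> kw; apply/legalP; exists k, a, w; split=> //;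
  apply: infix_refl. Qed.

Lemma legal1 a : legal P [:: a].
Proof. by apply: (@reach_legal 0 a); rewrite reach0. Qed.

Lemma decoding_extend w : exists d, valid d /\ src d = w.
Proof.
elim: w => [|a w [d [vd <-]]]; first by exists [::].
have /fset0Pn[s s_in] := rs_img_nonempty P a.
by exists ((a, s) :: d); rewrite /= s_in.
Qed.

(** The letters around [src d] in a reached word are given arbitrary blocks, which completes [d] to
    a decoding of the whole word. *)
Lemma legal_img d : valid d -> legal P (src d) -> legal P (img d).
Proof.
move=> vd /legalP[k [a [w [aw /infixP[x [y xy]]]]]].
have [dx [vx xE]] := decoding_extend x; have [dy [vy yE]] := decoding_extend y.
apply/legalP; exists k.+1, a, (img (dx ++ d ++ dy)); split.
  apply/reachSP; exists (dx ++ d ++ dy); split=> //.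
    by rewrite !valid_cat vx vd.
  by rewrite !src_cat xE yE -xy.
by rewrite !img_cat; apply/infixP; exists (img dx), (img dy).
Qed.

End Decodings.
(** * Letter counts and the substitution matrix *)

Lemma sum_count_mem (V : zmodType) (T : finType) (F : T -> V) (w : seq T) :
  \sum_(x <- w) F x = \sum_(a : T) F a *+ count_mem a w.
Proof.
elim: w => [|x w IH]; first by rewrite big_nil big1.
rewrite big_cons IH [RHS](eq_bigr (fun a =>
  F a *+ (x == a) + F a *+ count_mem a w)).
  rewrite big_split /=; congr (_ + _).
  rewrite (bigD1 x)//= eqxx mulr1n big1 ?addr0// => a.
  by rewrite eq_sym => /negPf ->.
by move=> a _; rewrite /= mulrnDr.
Qed.

Lemma size_sum_count (T : finType) (w : seq T) :
  size w = (\sum_(a : T) count_mem a w)%N.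
Proof.
elim: w => [|x w IH]; first by rewrite big1.
rewrite /= IH big_split /= -add1n; congr addn.
rewrite (bigD1 x)//= eqxx big1// => a.
by rewrite eq_sym => /negPf ->.
Qed.

Section Compatible.
Context (R : realType) (A : alphabetType) (P : random_substitution R A).
Hypothesis compat : compatible P.

Definition block0 (a : A) : seq A := xchoose (fset0Pn _ (rs_img_nonempty P a)).

Lemma block0P a : block0 a \in rs_img P a.
Proof. exact: xchooseP. Qed.

(* By compatibility the choice of the block does not matter. *)
Definition mult (a b : A) : nat := count_mem b (block0 a).

Lemma count_block a b s : s \in rs_img P a -> count_mem b s = mult a b.
Proof.
by move=> sa; have := compat b sa (block0P a); rewrite !occE !nocc1.
Qed.

Lemma size_block a s : s \in rs_img P a -> size s = (\sum_b mult a b)%N.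
Proof.
move=> sa; rewrite size_sum_count; apply: eq_bigr => b _.
exact: count_block.
Qed.

Lemma img_sizeE a s : s \in rs_img P a -> img_size P a = size s.
Proof.
move=> sa; rewrite (size_block sa) /img_size.
rewrite (eq_big_seq (fun _ => \sum_b mult a b)%N); last first.
  by move=> t ta; rewrite (size_block ta).
apply/eqP; rewrite eqn_leq; apply/andP; split.
  by apply/bigmax_leqP_seq => i _ _.
exact: (@leq_bigmax_seq _ (enum_fset (rs_img P a)) xpredT
  (fun _ => \sum_b mult a b)%N s sa isT).
Qed.

Lemma img_size_mult a : img_size P a = (\sum_b mult a b)%N.
Proof. by rewrite (img_sizeE (block0P a)) (size_block (block0P a)). Qed.

Lemma img_size_gt0 a : (0 < img_size P a)%N.
Proof.
rewrite (img_sizeE (block0P a)) lt0n size_eq0.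
exact: (rs_word_nonempty (block0P a)).
Qed.

Definition max_size : nat := \max_(a : A) img_size P a.

Lemma img_size_max a : (img_size P a <= max_size)%N.
Proof. exact: leq_bigmax. Qed.

Lemma max_size_gt0 : (0 < max_size)%N.
Proof. exact: leq_trans (img_size_gt0 point) (img_size_max _). Qed.

Lemma block_le_max p s : s \in rs_img P p -> (0 < size s <= max_size)%N.
Proof. by move=> sp; rewrite -(img_sizeE sp) img_size_gt0 img_size_max. Qed.

Lemma size_img d : valid P d -> size (img d) = (\sum_(p <- d) img_size P p.1)%N.
Proof.
elim: d => [|p d IH] /=; first by rewrite big_nil.
by move=> /andP[pv dv]; rewrite size_cat big_cons -IH// (img_sizeE pv).
Qed.

Lemma size_img_ge d : valid P d -> (size d <= size (img d))%N.
Proof.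
elim: d => [|p d IH] //= /andP[pv dv].
by rewrite size_cat -add1n leq_add ?IH//; case/andP: (block_le_max pv).
Qed.

Lemma size_img_le d : valid P d -> (size (img d) <= size d * max_size)%N.
Proof.
elim: d => [|p d IH] //= /andP[pv dv].
by rewrite size_cat mulSn leq_add ?IH//; case/andP: (block_le_max pv).
Qed.

Lemma count_img b d : valid P d ->
  count_mem b (img d) = (\sum_a count_mem a (src d) * mult a b)%N.
Proof.
elim: d => [|p d IH] /=; first by rewrite big1.
move=> /andP[pv dv]; rewrite count_cat IH// (count_block _ pv).
under [RHS]eq_bigr do rewrite mulnDl.
rewrite big_split /=; congr addn.
rewrite (bigD1 p.1)//= eqxx mul1n big1 ?addn0// => a.
by rewrite eq_sym => /negPf ->.
Qed.

Lemma law_mean_sum (l : word_law R A) (F : A -> seq A -> nat) :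
  law_mean l (fun w => \sum_a F a w)%N = \sum_a law_mean l (F a).
Proof.
rewrite /law_mean exchange_big /=; apply: eq_bigr => w _.
by rewrite natr_sum mulr_sumr.
Qed.

Lemma law_meanM (l : word_law R A) (F : seq A -> nat) n :
  law_mean l (fun w => F w * n)%N = law_mean l F * n%:R.
Proof.
by rewrite /law_mean mulr_suml; apply: eq_bigr => w _; rewrite natrM mulrA.
Qed.

Lemma eq_law_mean (l : word_law R A) (F G : seq A -> nat) :
  F =1 G -> law_mean l F = law_mean l G.
Proof. by move=> FG; apply: eq_bigr => w _; rewrite FG. Qed.

(** For a compatible substitution this is the entry in row [b] and column [a] of the [k]-th power of
    the substitution matrix. *)
Definition letters k a b : R := law_mean (iter_law P k [:: a]) (occ [:: b]).
Definition len k a : R := law_mean (iter_law P k [:: a]) size.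

Lemma law_mean_subst_count w b :
  law_mean (subst_law P w) (occ [:: b]) = (\sum_a count_mem a w * mult a b)%:R.
Proof.
rewrite law_mean_subst -[RHS]mul1r -(sum_pr P w) mulr_suml.
apply: eq_big_seq => d; rewrite mem_decodings => /andP[vd /eqP <-].
by rewrite occE nocc1 count_img.
Qed.

Lemma lettersS k a b :
  letters k.+1 a b = \sum_c letters k a c * (mult c b)%:R.
Proof.
rewrite /letters law_mean_iterS.
under [RHS]eq_bigr do rewrite -law_meanM.
rewrite -law_mean_sum; apply: eq_bigr => w _; congr (_ * _).
rewrite law_mean_subst_count; congr (_%:R); apply: eq_bigr => c _.
by rewrite occE nocc1.
Qed.

Lemma letters0 a b : letters 0 a b = (a == b)%:R.
Proof. by rewrite /letters /law_mean big_seq1 mul1r occE nocc1 /= addn0. Qed.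

(** [lettersS] splits off the last substitution step, this one the first; the latter is what
    desubstituting further down requires. *)
Lemma lettersSl k a b :
  letters k.+1 a b = \sum_c (mult a c)%:R * letters k c b.
Proof.
elim: k a b => [|k IH] a b.
  rewrite lettersS (bigD1 a)//= letters0 eqxx mul1r big1 ?addr0; last first.
    by move=> c; rewrite letters0 eq_sym => /negPf ->; rewrite mul0r.
  rewrite (bigD1 b)//= letters0 eqxx mulr1 big1 ?addr0// => c.
  by rewrite letters0 => /negPf ->; rewrite mulr0.
rewrite lettersS; under eq_bigr do rewrite IH mulr_suml.
rewrite exchange_big /=; apply: eq_bigr => c _.
by rewrite lettersS mulr_sumr; apply: eq_bigr => e _; rewrite mulrA.
Qed.

Lemma lenE k a : len k a = \sum_b letters k a b.
Proof.
rewrite /len /letters -law_mean_sum; apply: eq_law_mean => w.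
by rewrite size_sum_count; apply: eq_bigr => b _; rewrite occE nocc1.
Qed.

Lemma letters_ge0 k a b : 0 <= letters k a b.
Proof.
elim: k b => [|k IH] b; first by rewrite letters0 ler0n.
by rewrite lettersS sumr_ge0// => c _; rewrite mulr_ge0.
Qed.

Lemma len_ge1 k a : 1 <= len k a.
Proof.
elim: k => [|k IH].
  by rewrite /len /law_mean big_seq1 mul1r.
apply: (le_trans IH); rewrite !lenE.
under [leRHS]eq_bigr do rewrite lettersS.
rewrite [leRHS]exchange_big /=; apply: ler_sum => c _.
rewrite -mulr_sumr ler_peMr ?letters_ge0// -natr_sum -img_size_mult ler1n.
exact: img_size_gt0.
Qed.

Lemma subst_matrixE i j :
  subst_matrix P i j = (mult (enum_val j) (enum_val i))%:R.
Proof.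
rewrite mxE -/(letters 1 _ _) lettersS (bigD1 (enum_val j))//= letters0 eqxx
  mul1r.
rewrite big1 ?addr0// => c; rewrite letters0 eq_sym => /negPf ->.
by rewrite mul0r.
Qed.

(** An occurrence of [e] at index [i] places [u] at distance [size x] after the start of block [i];
    as blocks are non-empty, distinct indices give distinct positions. *)
Lemma nocc_le_occ_img e d (u x y : seq A) : valid P d -> e != [::] ->
  u != [::] -> img e = x ++ u ++ y -> (nocc e d <= occ u (img d))%N.
Proof.
move=> vd e0 u0 eE; rewrite occE -!size_positions.
rewrite -(size_map (fun i => size (img (take i d)) + size x)%N).
apply: uniq_leq_size; last first.
  move=> j /mapP[k]; rewrite !mem_positions// => /prefixP[z dz] ->.
  rewrite -{2}(cat_take_drop k d) dz img_cat drop_cat ltnNge leq_addr /= addKn.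
  by rewrite img_cat eE -!catA drop_size_cat// prefix_prefix.
rewrite map_inj_in_uniq ?positions_uniq// => i j.
rewrite !mem_positions// => /(prefix_lt_size e0) i_d /(prefix_lt_size e0) j_d.
move=> /addIn; suff mono k l : (k < l)%N -> (l <= size d)%N ->
    (size (img (take k d)) < size (img (take l d)))%N.
  by case: (ltngtP i j) => // [ij|ji] E; [have := mono _ _ ij (ltnW j_d)|
     have := mono _ _ ji (ltnW i_d)]; rewrite E ltnn.
move=> kl ld; rewrite -(subnKC (ltnW kl)) takeD img_cat size_cat -[ltnLHS]addn0.
rewrite ltn_add2l; apply: leq_trans (size_img_ge _).
  by rewrite size_take size_drop; case: ifP => _; lia.
by apply: valid_infix vd; apply/infixP;
  exists (take k d), (drop (l - k) (drop k d)); rewrite !cat_take_drop.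
Qed.

Section Eigen.
Context (lam : R) (r : A -> R).
Hypothesis PFr : PF_right_eigenvector P lam r.

Lemma r_gt0 a : 0 < r a. Proof. by have [] := PFr. Qed.
Lemma r_sum : \sum_a r a = 1. Proof. by have [] := PFr. Qed.

Lemma sum_enum_val (F : A -> R) :
  \sum_a F a = \sum_(i < #|A|) F (enum_val i).
Proof.
rewrite (reindex (@enum_val A xpredT)) //=.
by apply: onW_bij; apply: enum_val_bij.
Qed.

Lemma r_eigen b : \sum_a (mult a b)%:R * r a = lam * r b.
Proof.
have [_ _ /matrixP/(_ (enum_rank b) ord0)] := PFr.
rewrite !mxE enum_rankK => <-; rewrite sum_enum_val.
by apply: eq_bigr => i _; rewrite subst_matrixE !mxE enum_rankK.
Qed.

Lemma r_img_size : \sum_a r a * (img_size P a)%:R = lam.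
Proof.
transitivity (\sum_b lam * r b); last by rewrite -mulr_sumr r_sum mulr1.
under [RHS]eq_bigr do rewrite -r_eigen.
rewrite [RHS]exchange_big /=; apply: eq_bigr => a _.
by rewrite -mulr_suml -natr_sum -img_size_mult mulrC.
Qed.

(** A letter in no block would have a zero row in the substitution matrix, against
    [lam * r a > 0]. *)
Lemma letter_in_block a : 0 < lam -> exists b, (0 < mult b a)%N.
Proof.
move=> lam0; apply/existsP; apply: contraT => /existsPn nb.
have : 0 < lam * r a by rewrite mulr_gt0 ?r_gt0.
rewrite -r_eigen big1 ?ltxx// => b _.
by have := nb b; rewrite lt0n negbK => /eqP ->; rewrite mul0r.
Qed.

Lemma r_letters k b : \sum_a r a * letters k a b = lam ^+ k * r b.
Proof.
elim: k b => [|k IH] b.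
  rewrite (bigD1 b)//= letters0 eqxx mulr1 big1 ?addr0 ?expr0 ?mul1r// => a.
  by rewrite letters0 => /negPf ->; rewrite mulr0.
under eq_bigr do rewrite lettersS mulr_sumr.
rewrite exchange_big /= exprS -mulrA mulrCA -r_eigen mulr_sumr.
apply: eq_bigr => c _; rewrite [RHS]mulrCA -IH mulr_sumr.
by apply: eq_bigr => a _; rewrite mulrA mulrC.
Qed.

Lemma r_len k : \sum_a r a * len k a = lam ^+ k.
Proof.
under eq_bigr do rewrite lenE mulr_sumr.
rewrite exchange_big /=; under eq_bigr do rewrite r_letters.
by rewrite -mulr_sumr r_sum mulr1.
Qed.

End Eigen.

End Compatible.
(** * Renormalisation of frequencies *)

Lemma cvg_sum_finType (R : realType) (I : finType) (F : I -> R^nat) (l : I ->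
  R) :
  (forall i, F i n @[n --> \oo] --> l i) ->
  \sum_i F i n @[n --> \oo] --> \sum_i l i.
Proof.
move=> Fl; elim: (index_enum I) => [|i s IH].
  by under eq_fun do rewrite big_nil; rewrite big_nil; exact: cvg_cst.
under eq_fun do rewrite big_cons; rewrite big_cons.
exact: cvgD.
Qed.

Section Frequencies.
Context (R : realType) (A : alphabetType) (P : random_substitution R A).
Context (lam : R) (r : A -> R) (mu : probability (config A) R).
Hypothesis compat : compatible P.
Hypothesis PFr : PF_right_eigenvector P lam r.
Hypothesis lam1 : 1 < lam.
Hypothesis freq : frequency_measure P mu.

Local Notation f := (freq_of P mu).
Local Notation letters := (letters P).
Local Notation len := (len P).

Lemma lam_gt0 : 0 < lam. Proof. exact: lt_trans lam1. Qed.

Lemma len_gt0 k a : 0 < len k a.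
Proof. by apply: lt_le_trans (len_ge1 compat k a). Qed.

(* By r_letters, r b is a convex combination of the proportions of b in the
   words produced from the letters a, all of which tend to the frequency of b. *)
Lemma freq_letter b : f [:: b] = r b.
Proof.
apply/eqP; rewrite -subr_eq0 -normr_le0; apply/ler_addgt0Pl => e e0.
rewrite addr0.
have : \forall k \near \oo, forall a,
  `|f [:: b] - letters k a b / len k a| <= e.
  apply: filter_forall => a.
  by have /cvgrPdist_le/(_ _ e0) := freq_cvg freq a (legal1 P b).
move=> [k _ /(_ k (leqnn k)) /= H].
have lamk : 0 < lam ^+ k by rewrite exprn_gt0 ?lam_gt0.
rewrite -(ler_pM2l lamk) -[X in X * `|_|]gtr0_norm// -normrM mulrBr.
rewrite -(r_letters compat PFr) -{1 2}(r_len compat PFr) !mulr_suml -sumrB.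
apply: le_trans (ler_norm_sum _ _ _) _; apply: ler_sum => a _.
have l0 := len_gt0 k a.
rewrite (_ : _ - _ = r a * len k a * (f [:: b] - letters k a b / len k a)).
  rewrite normrM gtr0_norm ?ler_wpM2l ?H ?mulr_ge0 ?ltW ?(r_gt0 PFr)//.
  by rewrite mulr_gt0 ?(r_gt0 PFr).
by field; rewrite gt_eqF.
Qed.

Lemma cvg_letters a b : letters k a b / len k a @[k --> \oo] --> r b.
Proof. by rewrite -freq_letter; apply: (freq_cvg freq a (legal1 P b)). Qed.

Lemma lenS k a : len k.+1 a = \sum_c letters k a c * (img_size P c)%:R.
Proof.
rewrite lenE; under eq_bigr do rewrite lettersS//.
rewrite exchange_big /=; apply: eq_bigr => c _.
by rewrite -mulr_sumr -natr_sum -img_size_mult.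
Qed.

Lemma cvg_len_ratio a : len k.+1 a / len k a @[k --> \oo] --> lam.
Proof.
rewrite -(r_img_size compat PFr).
under eq_fun do rewrite lenS mulr_suml.
apply: cvg_sum_finType => c; under eq_fun do rewrite mulrAC.
by apply: cvgM; [exact: cvg_letters|exact: cvg_cst].
Qed.

(** Counts at step [k] are divided by lengths at step [k.+1]; the ratio of consecutive lengths
    produces [lam^-1]. *)
Lemma cvg_mean_next (v : seq A) (c : R) : legal P v ->
  law_mean (iter_law P k [:: point]) (occ v) * c / len k.+1 point
    @[k --> \oo] --> lam^-1 * c * f v.
Proof.
move=> lv.
rewrite (_ : (fun k => _) = fun k =>
   (len k.+1 point / len k point)^-1 * c *
   (law_mean (iter_law P k [:: point]) (occ v) / len k point)).
  apply: cvgM; last exact: freq_cvg.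
  apply: cvgM; last exact: cvg_cst.
  by apply: cvgV (cvg_len_ratio _); rewrite gt_eqF ?lam_gt0.
apply/funext => k; field.
by rewrite !gt_eqF ?len_gt0.
Qed.

Lemma cvg_freq_next u : legal P u ->
  law_mean (iter_law P k.+1 [:: point]) (occ u) / len k.+1 point
    @[k --> \oo] --> f u.
Proof.
by move=> lu; have := freq_cvg freq point lu; rewrite -cvg_shiftS.
Qed.

Lemma mean_iterS_le k (u : seq A) e : valid P e -> e != [::] ->
  (forall d, valid P d -> legal P (src d) -> (occ u (img d) <= nocc e d)%N) ->
  law_mean (iter_law P k.+1 [:: point]) (occ u) <=
  law_mean (iter_law P k [:: point]) (occ (src e)) * pr P e.
Proof.
move=> ve e0 H; rewrite law_mean_iterS [in leRHS]/law_mean mulr_suml.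
rewrite !big_seq; apply: ler_sum => w win.
rewrite -mulrA ler_wpM2l ?(ltW (iter_law_gt0 win))//.
rewrite law_mean_subst -(mean_nocc _ ve e0) !big_seq; apply: ler_sum => d.
rewrite mem_decodings => /andP[vd /eqP dw].
rewrite ler_wpM2l ?(ltW (pr_gt0 vd))// ler_nat H// dw.
by apply: (@reach_legal _ _ _ k point); apply: map_f.
Qed.

Lemma mean_iterS_ge k (u : seq A) e : valid P e -> e != [::] ->
  (forall d, valid P d -> (nocc e d <= occ u (img d))%N) ->
  law_mean (iter_law P k [:: point]) (occ (src e)) * pr P e <=
  law_mean (iter_law P k.+1 [:: point]) (occ u).
Proof.
move=> ve e0 H; rewrite law_mean_iterS [in leLHS]/law_mean mulr_suml.
rewrite !big_seq; apply: ler_sum => w win.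
rewrite -mulrA ler_wpM2l ?(ltW (iter_law_gt0 win))//.
rewrite law_mean_subst -(mean_nocc _ ve e0) !big_seq; apply: ler_sum => d.
rewrite mem_decodings => /andP[vd /eqP dw].
by rewrite ler_wpM2l ?(ltW (pr_gt0 vd))// ler_nat H.
Qed.

(** The counting hypothesis is what recognisability will supply. Legal sources suffice in it,
    because the Markov chain only visits legal words. *)
Lemma freq_le u e : valid P e -> e != [::] -> legal P u -> legal P (src e) ->
  (forall d, valid P d -> legal P (src d) -> (occ u (img d) <= nocc e d)%N) ->
  f u <= lam^-1 * pr P e * f (src e).
Proof.
move=> ve e0 lu le H.
apply: (ler_cvg_to (cvg_freq_next lu) (cvg_mean_next (c := pr P e) le)).
near=> k; rewrite ler_pM2r ?invr_gt0 ?len_gt0//.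
exact: mean_iterS_le.
Unshelve. all: by end_near. Qed.

Lemma freq_ge u e : valid P e -> e != [::] -> legal P u -> legal P (src e) ->
  (forall d, valid P d -> (nocc e d <= occ u (img d))%N) ->
  lam^-1 * pr P e * f (src e) <= f u.
Proof.
move=> ve e0 lu le H.
apply: (ler_cvg_to (cvg_mean_next (c := pr P e) le) (cvg_freq_next lu)).
near=> k; rewrite ler_pM2r ?invr_gt0 ?len_gt0//.
exact: mean_iterS_ge.
Unshelve. all: by end_near. Qed.

End Frequencies.
(** * Desubstitution and uniform letter frequencies *)

Section Desubstitution.
Context (R : realType) (A : alphabetType) (P : random_substitution R A).
Hypothesis compat : compatible P.

Local Notation B := (max_size P).

(** Blocks lying entirely to the left of [u] are dropped one at a time; the overhang left at the end
    is shorter than a block. *)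
Lemma trim_left d (u : seq A) : valid P d -> infix u (img d) -> u != [::] ->
  exists e x y, [/\ infix e d, img e = x ++ u ++ y & (size x <= B)%N].
Proof.
elim: d => [|p d IH]; first by case: u.
move=> /andP[pv dv] /infixP[x [y E]] u0.
have /andP[_ pB] := block_le_max compat pv.
have [le|lt] := leqP (size p.2) (size x); last first.
  exists (p :: d), x, y; split=> //.
    exact: infix_refl.
  by rewrite ltnW// (leq_trans lt).
have {}E : img d = drop (size p.2) x ++ u ++ y.
  rewrite -[LHS](@drop_size_cat _ _ p.2 _ erefl) -[p.2 ++ _]/(img (p :: d)) E.
  rewrite drop_cat ltn_neqAle le andbT; case: eqVneq => //= ->.
  by rewrite subnn drop0 drop_size.
have uI : infix u (img d) by rewrite E; apply: infix_catl; apply: infix_catr;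
  apply: infix_refl.
have [e [x' [y' [ed E' s]]]] := IH dv uI u0; exists e, x', y'; split=> //.
by apply: infix_trans ed _; rewrite -cat1s; apply: infix_catl;
  apply: infix_refl.
Qed.

Lemma trim_right d (x u y : seq A) : valid P d -> img d = x ++ u ++ y ->
  exists e y', [/\ infix e d, img e = x ++ u ++ y' & (size y' <= B)%N].
Proof.
elim/last_ind: d y => [|d p IH] y.
  case: x => //; case: u => //= _ /esym yE; exists [::], [::]; split=> //.
rewrite -cats1 valid_cat => /andP[dv]; rewrite /= andbT => pv.
have /andP[_ pB] := block_le_max compat pv.
rewrite img_cat {2}/img /= cats0 => E.
have [le|lt] := leqP (size p.2) (size y); last first.
  exists (d ++ [:: p]), y; split; first exact: infix_refl.
    by rewrite img_cat {2}/img /= cats0.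
  by rewrite ltnW// (leq_trans lt).
have sE := congr1 size E; rewrite !size_cat in sE.
have {}E : img d = x ++ u ++ take (size y - size p.2) y.
  rewrite -[LHS](@take_size_cat _ _ _ p.2 erefl) E catA take_cat size_cat ifF;
    last first.
    by apply/negbTE; rewrite -leqNgt; lia.
  by rewrite catA; congr (_ ++ take _ _); lia.
have [e [y' [ed E' s]]] := IH _ dv E; exists e, y'; split=> //.
by apply: infix_trans ed _; apply: infix_catr; apply: infix_refl.
Qed.

Lemma tight d (u : seq A) : valid P d -> infix u (img d) -> u != [::] ->
  exists e x y, [/\ infix e d, e != [::], img e = x ++ u ++ y &
    (size x + size y <= B.*2)%N].
Proof.
move=> dv ud u0; have [e [x [y [ed E xB]]]] := trim_left dv ud u0.
have [e' [y' [e'e E' yB]]] := trim_right (valid_infix ed dv) E.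
exists e', x, y'; split=> //; last by rewrite -addnn leq_add.
- exact: infix_trans e'e ed.
- by apply: contra_neq u0 => e0; move: E'; rewrite e0; case: x {E xB} => //;
  case: u {ud}.
Qed.

End Desubstitution.

Section Frequencies.
Context (R : realType) (A : alphabetType) (P : random_substitution R A).
Context (lam : R) (r : A -> R) (mu : probability (config A) R).
Hypothesis compat : compatible P.
Hypothesis PFr : PF_right_eigenvector P lam r.
Hypothesis lam1 : 1 < lam.
Hypothesis freq : frequency_measure P mu.

Local Notation f := (freq_of P mu).
Local Notation B := (max_size P).

(** A limit of positive ratios could vanish. Positivity is inherited through [freq_ge] from the
    source of a covering decoding, down to single letters, whose frequencies are the entries of
    [r]. *)
Lemma level_freq_gt0 k (u : seq A) : level P k u -> u != [::] -> 0 < f u.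
Proof.
elim: k u => [|k IH] u.
  move=> [a [w []]]; rewrite reach0 => /eqP -> /infixP[x [y]] E u0.
  suff -> : u = [:: a]
    by rewrite (freq_letter compat PFr lam1 freq) (r_gt0 PFr).
  case: x E => [|b x]; last by case: x; case: u u0.
  by case: u u0 => [|b [|c u]]//= _ [->].
move=> ku u0; have [d [dv dk ud]] := levelSP ku.
have [e [x [y [ed e0 E _]]]] := tight compat dv ud u0.
have ke : level P k (src e) by apply: level_infix dk; apply: src_infix.
have ve := valid_infix ed dv.
have fe : 0 < f (src e) by rewrite IH//; case: (e) e0.
apply: (lt_le_trans _ (freq_ge compat PFr lam1 freq ve e0 (level_legal ku)
  (level_legal ke) _)).
  by rewrite mulr_gt0// mulr_gt0 ?invr_gt0 ?(lam_gt0 lam1)// pr_gt0.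
by move=> d' vd'; apply: (nocc_le_occ_img compat vd' e0 u0 E).
Qed.

Lemma freq_gt0 u : legal P u -> u != [::] -> 0 < f u.
Proof. by move=> /legalP[k ku]; apply: level_freq_gt0 ku. Qed.

Definition info u := - ln (f u).
Definition cost (e : seq (A * seq A)) : R := - ln (pr P e).

Lemma cost_sum e : valid P e -> cost e = \sum_(p <- e) - ln (rs_prob P p.1 p.2).
Proof.
rewrite /cost /pr; elim: e => [|p e IH] /=; first by rewrite !big_nil ln1 oppr0.
move=> /andP[pv ev]; rewrite !big_cons lnM ?posrE ?(rs_prob_gt0 pv)//.
  by rewrite opprD IH.
exact: pr_gt0.
Qed.

Lemma info_le u e x y : valid P e -> e != [::] -> u != [::] ->
  legal P (src e) ->
  img e = x ++ u ++ y -> info u <= ln lam + cost e + info (src e).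
Proof.
move=> ve e0 u0 le E.
have lu : legal P u.
  apply: legal_infix (legal_img ve le); rewrite E.
  by apply: infix_catl; apply: infix_catr; apply: infix_refl.
have s0 : src e != [::] by case: (e) e0.
have := freq_ge compat PFr lam1 freq ve e0 lu le
  (fun d vd => nocc_le_occ_img compat vd e0 u0 E).
have l0 := lam_gt0 lam1; have fe := freq_gt0 le s0; have pe := pr_gt0 ve.
rewrite -ler_ln ?posrE ?freq_gt0 ?mulr_gt0 ?invr_gt0//.
rewrite !lnM ?posrE ?mulr_gt0 ?invr_gt0// lnV ?posrE// /info /cost.
lra.
Qed.

Lemma info_ge u e : valid P e -> e != [::] -> u != [::] -> legal P u ->
  legal P (src e) ->
  (forall d, valid P d -> legal P (src d) -> (occ u (img d) <= nocc e d)%N) ->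
  ln lam + cost e + info (src e) <= info u.
Proof.
move=> ve e0 u0 lu le H.
have s0 : src e != [::] by case: (e) e0.
have := freq_le compat PFr lam1 freq ve e0 lu le H.
have l0 := lam_gt0 lam1; have fe := freq_gt0 le s0; have pe := pr_gt0 ve.
rewrite -ler_ln ?posrE ?freq_gt0 ?mulr_gt0 ?invr_gt0//.
rewrite !lnM ?posrE ?mulr_gt0 ?invr_gt0// lnV ?posrE// /info /cost.
lra.
Qed.

(** A word of level 0 has no level below it; being at most one letter long, it is found inside some
    block. *)
Lemma legal_decode v : legal P v ->
  exists d, [/\ valid P d, legal P (src d) & infix v (img d)].
Proof.
move=> /legalP[[|k] kv]; last first.
  by have [d [dv /level_legal dl vd]] := levelSP kv; exists d.
have [a [w []]] := kv; rewrite reach0 => /eqP -> va.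
have [b ba] := letter_in_block compat PFr a (lam_gt0 lam1).
exists [:: (b, block0 P b)]; split; rewrite /= ?block0P//; first exact: legal1.
rewrite /img /= cats0; apply: infix_trans va _.
have : a \in block0 P b by rewrite -has_pred1 has_count.
by case/splitPr => x y; apply/infixP; exists x, y.
Qed.

Local Notation cnt b v := ((count_mem b v)%:R : R).

(** Each of the [k] desubstitutions errs only at the two ends of the word, so up to a constant
    independent of [v] its letter counts are those of a [k]-fold image of [w]. *)
Lemma desubst_counts k : exists C : R, forall v, legal P v ->
  exists2 w : seq A, legal P w &
  forall b, `|cnt b v - \sum_a cnt a w * letters P k a b| <= C.
Proof.
elim: k => [|k [C IH]].
  exists 0 => v lv; exists v => // b.
  rewrite (bigD1 b)//= letters0 eqxx mulr1 big1 ?addr0 ?subrr ?normr0// => a.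
  by rewrite letters0 => /negPf ->; rewrite mulr0.
(* [D] bounds what the at most [B.*2] overhanging letters become after [k] substitutions. *)
pose D : R := (B.*2)%:R * \sum_c \sum_b letters P k c b.
have D0 : 0 <= D by rewrite mulr_ge0// sumr_ge0// => c _;
  rewrite sumr_ge0// => b _; apply: letters_ge0.
exists (C + D) => v /IH[w lw wC].
(* [tight] requires a non-empty word; the empty word is kept as its own preimage. *)
have [wE|w0] := eqVneq w [::].
  exists [::]; first by rewrite -(take0 [:: point]);
    apply: legal_infix (legal1 P point); apply: infix_take.
  move=> b; move: (wC b); rewrite wE; under eq_bigr do rewrite mul0r.
  by under [in X in _ -> X]eq_bigr do rewrite mul0r; move=> /le_trans; apply;
    rewrite lerDl.
have [d [dv dl wd]] := legal_decode lw.
have [e [x [y [ed e0 E xyB]]]] := tight compat dv wd w0.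
exists (src e) => [|b]; first by apply: legal_infix dl; apply: src_infix.
have -> : \sum_a cnt a (src e) * letters P k.+1 a b =
          \sum_c cnt c (img e) * letters P k c b.
  under eq_bigr do rewrite lettersSl// mulr_sumr.
  rewrite exchange_big /=; apply: eq_bigr => c _.
  rewrite (count_img compat _ (valid_infix ed dv)) natr_sum mulr_suml.
  by apply: eq_bigr => a _; rewrite natrM mulrA.
rewrite (_ : _ - _ = (cnt b v - \sum_a cnt a w * letters P k a b) +
  \sum_a (cnt a w - cnt a (img e)) * letters P k a b); last first.
  rewrite [X in _ = _ + X](eq_bigr (fun a => cnt a w * letters P k a b -
    cnt a (img e) * letters P k a b)) => [|a _]; last by rewrite mulrBl.
  by rewrite sumrB; ring.
apply: le_trans (ler_normD _ _) _; apply: lerD => //.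
apply: le_trans (ler_norm_sum _ _ _) _; rewrite /D mulr_sumr;
  apply: ler_sum => c _.
rewrite normrM [X in _ * X]ger0_norm ?letters_ge0//; apply: ler_pM => //.
- exact: letters_ge0.
- rewrite E !count_cat !natrD -normrN ger0_norm.
    rewrite (_ : - _ = (count_mem c x + count_mem c y)%:R);
      last by rewrite natrD; ring.
    by rewrite ler_nat; apply: leq_trans xyB; rewrite leq_add// count_size.
  rewrite opprB -natrD -natrD subr_ge0 ler_nat; lia.
- by rewrite (bigD1 b)//= lerDl sumr_ge0// => a _; apply: letters_ge0.
Qed.

Lemma size_sumR (v : seq A) : (size v)%:R = \sum_a cnt a v.
Proof. by rewrite size_sum_count natr_sum. Qed.

(** For [k] large the [k]-fold images of all letters have letter proportions close to [r], and every
    legal word has, up to a constant, the letter counts of a concatenation of such images. *)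
Lemma uniform_frequency (eps : R) : 0 < eps -> exists2 C : R, 0 <= C &
  forall v, legal P v -> forall b,
    `|cnt b v - r b * (size v)%:R| <= eps * (size v)%:R + C.
Proof.
move=> eps0.
have : \forall k \near \oo, forall b a,
  `|r b - letters P k a b / len P k a| <= eps.
  apply: filter_forall => b; apply: filter_forall => a.
  by have /cvgrPdist_le/(_ _ eps0) := cvg_letters (b :=
    b) compat PFr lam1 freq a.
move=> [k _ /(_ k (leqnn k)) /= H].
have {}H a b : `|letters P k a b - r b * len P k a| <= eps * len P k a.
  have l0 := len_gt0 compat k a.
  rewrite -ler_pdivrMr// -[X in _ / X]gtr0_norm// -normfV -normrM mulrBl mulfK
    ?gt_eqF//.
  by rewrite distrC.
have [C HC] := desubst_counts k.
have C0 : 0 <= C.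
  have [w _ /(_ point)] := HC _ (legal1 P point); exact: le_trans.
set n : R := #|A|%:R.
(* The first term comes from replacing the count of [b] by [S b]; the others come from replacing [T]
   by [size v], at a cost of [n * C], in [eps * T] and in [r b * T]. *)
exists (C + eps * n * C + n * C) => [|v lv b].
  by rewrite !addr_ge0// ?mulr_ge0// ltW.
have [w lw wC] := HC v lv.
set S := fun b => \sum_a cnt a w * letters P k a b.
set T := \sum_a cnt a w * len P k a.
have TS : T = \sum_b S b.
  rewrite /T /S exchange_big /=; apply: eq_bigr => a _.
  by rewrite lenE mulr_sumr.
have sT : `|(size v)%:R - T| <= n * C.
  rewrite TS size_sumR -sumrB; apply: le_trans (ler_norm_sum _ _ _) _.
  rewrite /n -sum1_card natr_sum mulr_suml; apply: ler_sum => a _;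
    rewrite mul1r.
  exact: wC.
have bT : `|S b - r b * T| <= eps * T.
  rewrite /S /T !mulr_sumr -sumrB; apply: le_trans (ler_norm_sum _ _ _) _.
  apply: ler_sum => a _.
  rewrite mulrCA [leRHS]mulrCA -mulrBr normrM ger0_norm//.
  by apply: ler_wpM2l => //; apply: H.
have rb0 := ltW (r_gt0 PFr b).
have rb1 : r b <= 1.
  by rewrite -(r_sum PFr) (bigD1 b)//= lerDl sumr_ge0// => a _;
    rewrite ltW ?(r_gt0 PFr).
have T_le : T <= (size v)%:R + n * C by move: sT; rewrite ler_norml; lra.
rewrite (_ : _ - _ = (cnt b v - S b) + (S b - r b * T) + r b * (T - (size
  v)%:R)); last by ring.
apply: le_trans (ler_normD _ _) _; rewrite normrM (ger0_norm rb0) distrC.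
have h1 : r b * `|(size v)%:R - T| <= n * C.
  by apply: le_trans sT; rewrite ler_piMl.
have h2 : eps * T <= eps * (size v)%:R + eps * n * C.
  by rewrite -mulrA -mulrDr ler_wpM2l// ltW.
have h3 := ler_normD (cnt b v - S b) (S b - r b * T).
have := wC b; rewrite -/(S b); lra.
Qed.

Lemma uniform_sum (h : A -> R) (eps : R) : 0 < eps -> exists2 C : R, 0 <= C &
  forall v, legal P v ->
  `|\sum_(a <- v) h a - (\sum_a r a * h a) * (size v)%:R| <= eps * (size v)%:R
    + C.
Proof.
move=> eps0; set H := 1 + \sum_a `|h a|.
have H0 : 0 < H by rewrite ltr_pwDl// sumr_ge0.
have [C C0 HC] := uniform_frequency (divr_gt0 eps0 H0).
exists (H * C) => [|v lv]; first by rewrite mulr_ge0// ltW.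
rewrite sum_count_mem mulr_suml -sumrB.
apply: le_trans (ler_norm_sum _ _ _) _.
apply: (@le_trans _ _ (\sum_a `|h a| * (eps / H * (size v)%:R + C))).
  apply: ler_sum => a _.
  rewrite (_ : _ - _ = h a * (cnt a v - r a * (size v)%:R));
    last by rewrite -mulr_natr; ring.
  rewrite normrM ler_wpM2l//.
  exact: HC.
rewrite -mulr_suml.
have -> : eps * (size v)%:R + H * C = H * (eps / H * (size v)%:R + C).
  by field; rewrite gt_eqF.
apply: ler_wpM2r; last by rewrite /H lerDr.
by rewrite addr_ge0// mulr_ge0// divr_ge0// ltW.
Qed.

Lemma uniform_size_img (eps : R) : 0 < eps -> exists2 C : R, 0 <= C &
  forall e, valid P e -> legal P (src e) ->
  `|(size (img e))%:R - lam * (size e)%:R| <= eps * (size e)%:R + C.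
Proof.
move=> eps0; have [C C0 HC] := uniform_sum (fun a => (img_size P a)%:R) eps0.
exists C => // e ve le; have := HC _ le.
rewrite (r_img_size compat PFr) size_src (size_img compat ve) natr_sum.
by rewrite big_map.
Qed.

End Frequencies.
(** * Local recognisability *)

(** This pigeonhole principle plays the part of extracting a subsequence; the same [U] serves all
    coordinates at once, so no diagonal argument arises. *)
Lemma ultra_limit (T : eqType) (U : set_system nat) (f : nat -> T) (s : seq T) :
  UltraFilter U -> U [set k | f k \in s] -> exists a, U [set k | f k = a].
Proof.
move=> UU; elim: s => [|a s IH] fs.
  by have [k /=] := filter_ex fs; rewrite in_nil.
have [|nfa] := in_ultra_setVsetC [set k | f k = a] UU; first by exists a.
apply: IH; apply: filterS (filterI fs nfa) => k /=.
by rewrite in_cons => -[/orP[/eqP|]].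
Qed.

Lemma nat_ultrafilter : exists U : set_system nat,
  UltraFilter U /\ forall n, U [set k | (n <= k)%N].
Proof.
have [U [UU sub]] := ultraFilterLemma (_ : ProperFilter \oo).
by exists U; split=> // n; apply: sub; exists n.
Qed.

Lemma filter_ltn (U : set_system nat) {FU : Filter U} n (F : nat -> nat ->
  Prop) :
  (forall m, (m < n)%N -> U [set k | F m k]) ->
  U [set k | forall m, (m < n)%N -> F m k].
Proof.
move=> H; have : U [set k | forall m : 'I_n, F m k].
  by apply: filter_forall => m; apply: H.
by apply: filterS => k /= Fk m mn; have := Fk (Ordinal mn).
Qed.

Definition letter0 (A : alphabetType) : A := point.

Lemma subwordE (A : alphabetType) (x : int -> A) i n (w : seq A) p :
  (p + n <= size w)%N ->
  (forall m, (m < n)%N -> x (i + m%:Z) = nth (letter0 A) w (p + m)) ->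
  subword x i n = take n (drop p w).
Proof.
move=> pn H.
have sz : size (take n (drop p w)) = n by rewrite size_takel// size_drop; lia.
apply: (@eq_from_nth _ (letter0 A)); rewrite size_subword ?sz// => m mn.
by rewrite nth_subword// nth_take// nth_drop H.
Qed.

Section Positions.
Context (A : alphabetType).
Implicit Types d : seq (A * seq A).

Definition mark0 : A * seq A := (letter0 A, [::]).

Definition pos d j := size (img (take j d)).

Lemma pos0 d : pos d 0 = 0%N. Proof. by rewrite /pos take0. Qed.

Lemma posD d j l : pos d (j + l) = (pos d j + size (img (take l (drop j d))))%N.
Proof. by rewrite /pos takeD img_cat size_cat. Qed.

Lemma posS d j : (j < size d)%N ->
  pos d j.+1 = (pos d j + size (nth mark0 d j).2)%N.
Proof.
move=> jd; rewrite /pos (take_nth mark0)// -cats1 img_cat size_cat.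
by rewrite {2}/img /= cats0.
Qed.

Lemma pos_mono d j l : (j <= l)%N -> (pos d j <= pos d l)%N.
Proof. by move=> jl; rewrite -(subnKC jl) posD leq_addr. Qed.

Lemma pos_size d j : (size d <= j)%N -> pos d j = size (img d).
Proof. by move=> jd; rewrite /pos take_oversize. Qed.

Lemma pos_lt_size d j : (pos d j < size (img d))%N -> (j < size d)%N.
Proof. by case: (ltnP j (size d)) => // /pos_size ->; rewrite ltnn. Qed.

Lemma nth_img d j m : (j < size d)%N -> (m < size (nth mark0 d j).2)%N ->
  nth (letter0 A) (img d) (pos d j + m) = nth (letter0 A) (nth mark0 d j).2 m.
Proof.
move=> jd mj; rewrite -{1}(cat_take_drop j d) img_cat nth_cat ltnNge leq_addr
  /=.
by rewrite addKn (drop_nth mark0 jd) /img /= nth_cat mj.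
Qed.

Lemma locate d p : (p < size (img d))%N -> exists j t,
  [/\ (j < size d)%N, (t < size (nth mark0 d j).2)%N & p = (pos d j + t)%N].
Proof.
elim: d p => [|b d IH] p //;
  rewrite -cat1s img_cat size_cat {1}/img /= cats0 => pd.
have [lt|le] := ltnP p (size b.2); first by exists 0%N, p; rewrite pos0.
have [|j [t [jd td E]]] := IH (p - size b.2)%N; first by lia.
exists j.+1, t; split=> //.
by rewrite /pos /= -cat1s img_cat size_cat {1}/img /= cats0 -addnA -/(pos d j)
  -E subnKC.
Qed.

End Positions.

Section Recognisability.
Context (R : realType) (A : alphabetType) (P : random_substitution R A).
Hypothesis compat : compatible P.

Local Notation B := (max_size P).

Lemma nth_valid d j : valid P d -> (j < size d)%N ->
  (nth (mark0 A) d j).2 \in rs_img P (nth (mark0 A) d j).1.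
Proof. by move=> /allP vd jd; apply: vd; apply: mem_nth. Qed.

Lemma pos_lipschitz d j l : valid P d -> (pos d (j + l) <= pos d j + l * B)%N.
Proof.
move=> vd; rewrite posD leq_add2l.
have v : valid P (take l (drop j d)).
  apply: valid_infix vd; apply: infix_trans (infix_take _ _) (infix_drop _ _).
apply: leq_trans (size_img_le compat v) _; rewrite leq_mul2r size_take_min.
by rewrite geq_minl orbT.
Qed.

(** A legal decoding with a distinguished letter of its image, at offset [t] in block [j]; this
    letter becomes the origin when limits are taken. *)
Definition marked (d : seq (A * seq A)) j t :=
  [/\ valid P d, legal P (src d),
    (j < size d)%N & (t < size (nth (mark0 A) d j).2)%N].

Definition margin K (d : seq (A * seq A)) j t :=
  (K <= pos d j + t)%N /\ (pos d j + t + K < size (img d))%N.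

(** A block has at most [B] letters, so [n * B] letters on a side cover [n] blocks; the additional
    [B] pays for the marked block itself. *)
Lemma margin_index K d j t n : marked d j t -> margin K d j t ->
  (n.+1 * B <= K)%N -> (n < j)%N /\ (j + n < size d)%N.
Proof.
move=> [vd ld jd tj] [Kl Kr] nK.
have h1 : (pos d j.+1 <= j.+1 * B)%N by have := pos_lipschitz 0 j.+1 vd;
  rewrite pos0.
have h2 : (pos d (size d) <= pos d j + (size d - j) * B)%N.
  by have := pos_lipschitz j (size d - j) vd; rewrite subnKC// ltnW.
rewrite pos_size// in h2; rewrite posS// in h1.
split.
  by rewrite -ltnS -(@ltn_pmul2r B) ?max_size_gt0//; lia.
have : (n.+1 * B < (size d - j) * B)%N by lia.
by rewrite ltn_pmul2r ?max_size_gt0//; lia.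
Qed.

(** * Limits of marked decodings along an ultrafilter *)

Section Limit.
Context (U : set_system nat) (UU : UltraFilter U).
Hypothesis Uoo : forall n, U [set k | (n <= k)%N].
Context (d : nat -> seq (A * seq A)) (j t : nat -> nat).
Hypothesis dm : forall k, marked (d k) (j k) (t k).
Hypothesis dk : forall k, margin k (d k) (j k) (t k).

Local Notation q k := (pos (d k) (j k) + t k)%N.
Local Notation letter_at i k :=
  (nth (letter0 A) (img (d k)) (absz ((q k)%:Z + i)%R)).
Local Notation mark_at l k := (nth (mark0 A) (d k) (absz ((j k)%:Z + l)%R)).

Lemma ultra_index (l : int) :
  U [set k | 0 <= (j k)%:Z + l /\ (absz ((j k)%:Z + l)%R < size (d k))%N].
Proof.
apply: filterS (Uoo ((absz l).+1 * B)) => k /= lk.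
by have := margin_index (dm k) (dk k) lk; lia.
Qed.

Lemma ultra_letter (i : int) : exists a : A, U [set k | letter_at i k = a].
Proof.
apply: (@ultra_limit _ U _ (enum A)) => //.
by apply: filterS filterT => k _ /=; rewrite mem_enum.
Qed.

Lemma ultra_mark (l : int) : exists p : A * seq A, U [set k | mark_at l k = p].
Proof.
apply: (@ultra_limit _ U _ [seq (a, s) | a <- enum A, s <- rs_img P a]) => //.
apply: filterS (ultra_index l) => k /= [_ lk].
have [vd _ _ _] := dm k; have s_in := nth_valid vd lk.
apply/allpairsPdep; exists (mark_at l k).1, (mark_at l k).2.
by split=> //; [rewrite mem_enum|case: (mark_at l k)].
Qed.

(** Relative to the marked block the cut of index [l] is displaced by at most [M] in absolute value,
    so it takes finitely many values. *)
Lemma ultra_cut (l : int) : exists c : int,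
  U [set k | (pos (d k) (absz ((j k)%:Z + l)%R))%:Z - (pos (d k) (j k))%:Z = c].
Proof.
pose M := (absz l * B)%N.
apply: (@ultra_limit _ U _ [seq n%:Z - M%:Z | n <- iota 0 (M.*2.+1)]) => //.
apply: filterS (ultra_index l) => k; rewrite /mkset => -[l0 _].
have [vd _ _ _] := dm k.
pose a := absz ((j k)%:Z + l)%R.
have [ja|aj] := leqP (j k) a.
  have h1 := pos_mono (d k) ja; have h2 := pos_lipschitz (j k) (absz l) vd.
  have aE : a = (j k + absz l)%N by rewrite /a; lia.
  rewrite -/a aE; rewrite aE in h1.
  apply/mapP; exists (pos (d k) (j k + absz l) - pos (d k) (j k) + M)%N.
    by rewrite mem_iota /M; lia.
  by lia.
have h1 := pos_mono (d k) (ltnW aj); have h2 := pos_lipschitz a (absz l) vd.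
have aE : j k = (a + absz l)%N by rewrite /a; lia.
rewrite -aE in h2; rewrite -/a.
apply/mapP; exists (M - (pos (d k) (j k) - pos (d k) a))%N.
  by rewrite mem_iota /M; lia.
by lia.
Qed.

(* The centred decodings converge, along U, to a point of the subshift together
   with its preimage. *)
Lemma ultra_decoding : exists (x y : int -> A) (tau : nat),
  [/\ forall i, U [set k | letter_at i k = x i],
      U [set k | nth (mark0 A) (d k) (j k) =
                 (y 0, subword x (- tau%:Z) (img_size P (y 0)))],
      U [set k | t k = tau], subshift P x &
      [/\ subshift P y, (tau < img_size P (y 0))%N &
          subst_seq P y (shift_back tau x)]].
Proof.
have FU : Filter U by apply: filter_filter.
have [x xP] := choice ultra_letter; have [p pP] := choice ultra_mark.
have [c cP] := choice ultra_cut.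
have [tau tauP] : exists tau, U [set k | t k = tau].
  apply: (@ultra_limit _ U _ (iota 0 B)) => //.
  apply: filterS filterT => k _ /=; have [vd _ jd tj] := dm k.
  rewrite mem_iota /=; apply: leq_trans tj _.
  by have /andP[] := block_le_max compat (nth_valid vd jd).
pose y i := (p i).1; pose v i := (p i).2.
(* Finitely many members of [U] meet, so a whole subword of [x] is read off from a single legal word
   [img (d k)]. *)
have xX : subshift P x.
  move=> i n.
  have H := filter_ltn (FU := FU) (n := n) (F := fun m k =>
    letter_at (i + m%:Z) k = x (i + m%:Z)) (fun m _ => xP _).
  have [k /= [kx kn]] := filter_ex (filterI H (Uoo (absz i + n)%N)).
  have [vd ld jd tj] := dm k; have [kl kr] := dk k.
  rewrite (@subwordE _ x i n (img (d k)) (absz ((q k)%:Z + i)%R)).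
  - apply: legal_infix (legal_img vd ld).
    exact: infix_trans (infix_take _ _) (infix_drop _ _).
  - by lia.
  - by move=> m mn; rewrite -kx//; congr nth; lia.
have yX : subshift P y.
  move=> i n.
  have H := filter_ltn (FU := FU) (n := n) (F := fun m k =>
    mark_at (i + m%:Z) k = p (i + m%:Z)) (fun m _ => pP _).
  have [k /= [kp [kn [i0 _]]]] :=
    filter_ex (filterI H (filterI (ultra_index (i + n%:Z)) (ultra_index i))).
  have [vd ld jd tj] := dm k.
  rewrite (@subwordE _ y i n (src (d k)) (absz ((j k)%:Z + i)%R)).
  - apply: legal_infix ld.
    exact: infix_trans (infix_take _ _) (infix_drop _ _).
  - by rewrite size_src; lia.
  - move=> m mn; rewrite /y -kp// /src (nth_map (mark0 A)); last by lia.
    by congr (nth _ _ _).1; lia.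
have vy l : v l \in rs_img P (y l).
  have [k /= [kp [_ kl]]] := filter_ex (filterI (pP l) (ultra_index l)).
  have [vd _ _ _] := dm k.
  by rewrite /v /y -kp; apply: nth_valid.
(* Shifting by [tau] moves the origin from the marked letter to the start of its block, from which
   the cuts [c] are measured. *)
have vsub l : subword (shift_back tau x) (c l) (size (v l)) = v l.
  have H := filter_ltn (FU := FU) (n := size (v l)) (F := fun m k =>
    letter_at (c l + m%:Z - tau%:Z) k = x (c l + m%:Z - tau%:Z)) (fun m _ =>
    xP _).
  have [k /= [kx [kp [kc [kt [k0 kl]]]]]] :=
    filter_ex (filterI H (filterI (pP l) (filterI (cP l) (filterI tauP
    (ultra_index l))))).
  apply: (@eq_from_nth _ (letter0 A)); rewrite size_subword// => m mn.
  rewrite nth_subword// /shift_back -kx// -kc kt.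
  rewrite (_ : absz _ = pos (d k) (absz ((j k)%:Z + l)%R) + m)%N; last by lia.
  by rewrite nth_img// kp.
have c0 : c 0 = 0.
  have [k] := filter_ex (cP 0); rewrite /mkset => <-.
  by rewrite (_ : absz _ = j k) ?subrr//; lia.
exists x, y, tau; split=> //.
- have -> : subword x (- tau%:Z) (img_size P (y 0)) = v 0.
    rewrite (img_sizeE compat (vy 0)) -[RHS]vsub c0.
    by apply: eq_map => m; rewrite /shift_back; congr x; lia.
  rewrite -surjective_pairing.
  by apply: filterS (pP 0) => k; rewrite /mkset => <-; congr nth; lia.
- split=> //.
    have [k [kp kt]] := filter_ex (filterI (pP 0) tauP);
      rewrite /mkset in kp kt.
    have [_ _ _ tj] := dm k.
    rewrite (img_sizeE compat (vy 0)) -kt; apply: leq_trans tj _.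
    by rewrite /v -kp; rewrite (_ : absz _ = j k)//; lia.
  exists v, c; split=> // l.
  have [k /= [kp [kc [kc' [k0 kl]]]]] :=
    filter_ex (filterI (pP l) (filterI (cP l) (filterI (cP (l + 1))
    (ultra_index l)))).
  rewrite -kc -kc' (_ : absz ((j k)%:Z + (l + 1)) = (absz ((j k)%:Z +
    l)%R).+1); last by lia.
  by rewrite posS// kp /v; lia.
Qed.

End Limit.

(** Otherwise there are pairs of decodings whose images agree on ever larger windows around the
    marks, but which differ at the marks; in the limit they give two preimages of one point. *)
Lemma local_recognisability : recognisable P -> exists K : nat,
  forall d j t d' j' t', marked d j t -> marked d' j' t' ->
    margin K d j t -> margin K d' j' t' ->
    (forall i : int, (absz i <= K)%N ->
       nth (letter0 A) (img d) (absz ((pos d j + t)%N%:Z + i)%R) =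
       nth (letter0 A) (img d') (absz ((pos d' j' + t')%N%:Z + i)%R)) ->
    t = t' /\ nth (mark0 A) d j = nth (mark0 A) d' j'.
Proof.
move=> recog; apply: contrapT => /forallNP bad.
have {}bad K : exists z : (seq (A * seq A) * nat * nat) * (seq (A * seq A) *
  nat * nat),
  [/\ marked z.1.1.1 z.1.1.2 z.1.2, marked z.2.1.1 z.2.1.2 z.2.2,
    margin K z.1.1.1 z.1.1.2 z.1.2, margin K z.2.1.1 z.2.1.2 z.2.2 &
    (forall i : int, (absz i <= K)%N ->
       nth (letter0 A) (img z.1.1.1) (absz ((pos z.1.1.1 z.1.1.2 + z.1.2)%N%:Z
         + i)%R) =
       nth (letter0 A) (img z.2.1.1) (absz ((pos z.2.1.1 z.2.1.2 + z.2.2)%N%:Z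
         + i)%R)) /\
    ~ (z.1.2 = z.2.2 /\ nth (mark0 A) z.1.1.1 z.1.1.2 = nth (mark0 A) z.2.1.1
      z.2.1.2)].
  apply: contrapT => nex; apply: (bad K) => d j t d' j' t' h1 h2 h3 h4 h5.
  by apply: contrapT => nc; apply: nex; exists ((d, j, t), (d', j', t')).
have [z zP] := choice bad.
(* Both sequences use the same ultrafilter, so the two limits can be compared at a common index. *)
have [U [UU Uoo]] := nat_ultrafilter.
have [x [y [tau [xl yl tl xX yX]]]] := @ultra_decoding U UU Uoo
  (fun k => (z k).1.1.1) (fun k => (z k).1.1.2) (fun k => (z k).1.2)
  (fun k => let: And5 h _ _ _ _ := zP k in h) (fun k =>
    let: And5 _ _ h _ _ := zP k in h).
have [x' [y' [tau' [xl' yl' tl' xX' yX']]]] := @ultra_decoding U UU Uoo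
  (fun k => (z k).2.1.1) (fun k => (z k).2.1.2) (fun k => (z k).2.2)
  (fun k => let: And5 _ h _ _ _ := zP k in h) (fun k =>
    let: And5 _ _ _ h _ := zP k in h).
have xx' : x' = x.
  apply/funext => i.
  have [k /= [k1 [k2 k3]]] :=
    filter_ex (filterI (xl i) (filterI (xl' i) (Uoo (absz i)))).
  by have [_ _ _ _ [H _]] := zP k; rewrite -k1 -k2 H.
rewrite xx' in yl' yX'.
have [w [_ uniq]] := recog x xX.
have E1 := uniq (y, tau) yX; have E2 := uniq (y', tau') yX'.
have [Ey Et] : y = y' /\ tau = tau' by move: E2; rewrite E1 => -[].
have [k /= [k1 [k2 [k3 k4]]]] :=
  filter_ex (filterI yl (filterI yl' (filterI tl tl'))).
have [_ _ _ _ [_]] := zP k; apply.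
by rewrite k1 k2 k3 k4 Ey Et.
Qed.

Lemma prefix_nth (T : eqType) (x0 : T) (s1 s2 : seq T) (q m : nat) :
  prefix s1 (drop q s2) -> (m < size s1)%N -> nth x0 s2 (q + m) = nth x0 s1 m.
Proof. by move=> /prefixP[z E] ms; rewrite -nth_drop E nth_cat ms. Qed.

Lemma prefix_size (T : eqType) (s1 s2 : seq T) (q : nat) : s1 != [::] ->
  prefix s1 (drop q s2) -> (q + size s1 <= size s2)%N.
Proof.
move=> s0 ps; have qs := prefix_lt_size s0 ps.
by have := size_prefix ps; rewrite size_drop; lia.
Qed.

(** [e] consists of the blocks of [d0] that meet the positions of [u] at distance at least [K] from
    its ends. Local recognisability determines each of them from [u] alone, so they reappear
    wherever [u] does. *)
Lemma recognisable_trim : recognisable P -> exists M : nat,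
  forall d0 u, valid P d0 -> legal P (src d0) -> infix u (img d0) ->
    (M <= size u)%N ->
  exists e, [/\ infix e d0, e != [::], (size u <= size (img e) + M)%N,
    (size (img e) <= size u)%N &
    forall d, valid P d -> legal P (src d) -> (occ u (img d) <= nocc e d)%N].
Proof.
move=> /local_recognisability[K0 LR].
(* [K0] is the window of local recognisability; the extra [B] keeps the first and the last chosen
   block inside [u]. With [K.*2.+1] letters some position has [K] letters on both sides. *)
have [K KE] : exists K, K = (K0 + B)%N by exists (K0 + B)%N.
exists (K.*2.+1) => d0 u vd0 ld0 ud0 uM.
set n := size u in uM *.
have u0 : u != [::] by rewrite -size_eq0 -/n; lia.
have [q0 q0P] : exists q0, prefix u (drop q0 (img d0)).
  move: ud0 => /infixP[x [y ->]]; exists (size x).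
  by rewrite drop_size_cat// prefix_prefix.
have q0n : (q0 + n <= size (img d0))%N := prefix_size u0 q0P.
(* A letter of [u] away from its ends is decoded alike in [d0] and in any [d] whose image contains
   [u]. *)
have key d q j t j' t' m : valid P d -> legal P (src d) ->
  prefix u (drop q (img d)) ->
    (K <= m)%N -> (m + K < n)%N ->
    (j < size d0)%N -> (t < size (nth (mark0 A) d0 j).2)%N ->
      (pos d0 j + t = q0 + m)%N ->
    (j' < size d)%N -> (t' < size (nth (mark0 A) d j').2)%N ->
      (pos d j' + t' = q + m)%N ->
    t = t' /\ nth (mark0 A) d0 j = nth (mark0 A) d j'.
  move=> vd ld qP Km mK jd tj E j'd t'j' E'.
  have qn : (q + n <= size (img d))%N := prefix_size u0 qP.
  apply: LR => //; [rewrite /margin; lia|rewrite /margin; lia|].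
  move=> l lK; rewrite E E'.
  pose m' := absz (m%:Z + l).
  rewrite (_ : absz _ = q0 + m')%N; last by rewrite /m'; lia.
  rewrite (_ : absz _ = q + m')%N; last by rewrite /m'; lia.
  by rewrite (prefix_nth _ q0P) ?(prefix_nth _ qP)// -/n /m'; lia.
have [|j0 [t0 [j0d t0j E0]]] := @locate _ d0 (q0 + K); first by lia.
have [|j1 [t1 [j1d t1j E1]]] := @locate _ d0 (q0 + (n - K.+1)); first by lia.
have blk d j : valid P d -> (j < size d)%N ->
  (0 < size (nth (mark0 A) d j).2 <= B)%N.
  by move=> vd jd; apply: (block_le_max compat (nth_valid vd jd)).
have j01 : (j0 <= j1)%N.
  rewrite leqNgt; apply/negP => lt.
  by have := pos_mono d0 lt; rewrite posS//; lia.
have D0 : (q0 <= pos d0 j0)%N by have := blk _ _ vd0 j0d; lia.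
pose e := take (j1 - j0).+1 (drop j0 d0).
have se : size e = (j1 - j0).+1 by rewrite size_takel// size_drop; lia.
have pe : pos d0 j1.+1 = (pos d0 j0 + size (img e))%N.
  by rewrite -posD; congr pos; lia.
have pj1 := posS j1d; have b1 := blk _ _ vd0 j1d; have b0 := blk _ _ vd0 j0d.
have eN : e != [::] by rewrite -size_eq0 se.
exists e; split=> //.
- exact: infix_trans (infix_take _ _) (infix_drop _ _).
- by lia.
- by lia.
move=> d vd ld; rewrite occE -!size_positions.
(* An occurrence of [e] is sent to the place where [u] should start; it suffices that every
   occurrence of [u] is hit. *)
rewrite -(size_map (fun j => pos d j - (pos d0 j0 - q0))%N (positions e d)).
apply: uniq_leq_size; first exact: positions_uniq.
move=> q; rewrite mem_positions// => qP.
have qn : (q + n <= size (img d))%N := prefix_size u0 qP.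
have [|j [t [jd tj E]]] := @locate _ d (q + K); first by lia.
have [tt jj] : t0 = t /\ nth (mark0 A) d0 j0 = nth (mark0 A) d j.
  by apply: (key d q j0 t0 j t K) => //; lia.
(* As long as the blocks agree, so do their end points; the next block then starts at the same place
   of [u] in both decodings, and [key] applies there with offset 0. *)
have step l : (l <= j1 - j0)%N -> [/\ (j + l < size d)%N,
    (pos d (j + l) + q0 = pos d0 (j0 + l) + q)%N &
    nth (mark0 A) d (j + l) = nth (mark0 A) d0 (j0 + l)].
  elim: l => [|l IH] lj; first by rewrite !addn0; split=> //; lia.
  have [jld El nl] := IH (ltnW lj).
  have j0ld : (j0 + l < size d0)%N by lia.
  have El' : (pos d (j + l.+1) + q0 = pos d0 (j0 + l.+1) + q)%N.
    by rewrite !addnS !posS// nl; lia.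
  have h1 : (pos d0 (j0 + l.+1) <= pos d0 j1)%N by apply: pos_mono; lia.
  have h2 : (pos d0 j0.+1 <= pos d0 (j0 + l.+1))%N by apply: pos_mono; lia.
  rewrite posS// in h2.
  have j'd : (j + l.+1 < size d)%N by apply: pos_lt_size; lia.
  have j0'd : (j0 + l.+1 < size d0)%N by lia.
  split=> //; symmetry.
  have /andP[b _] := blk _ _ vd j'd; have /andP[b' _] := blk _ _ vd0 j0'd.
  by apply: (proj2 (key d q (j0 + l.+1)%N 0%N (j + l.+1)%N 0%N (pos d0 (j0 +
    l.+1) - q0)%N _ _ _ _ _ _ _ _ _ _ _)) => //; lia.
apply/mapP; exists j; last first.
  by have [_ ] := step 0%N isT; rewrite !addn0; lia.
rewrite mem_positions//; apply/prefixP.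
exists (drop (size e) (drop j d)); rewrite -[LHS](cat_take_drop (size e));
  congr (_ ++ _).
have [jd' _ _] := step _ (leqnn _).
have ste : size (take (size e) (drop j d)) = size e.
  by rewrite size_takel// size_drop se; lia.
apply: (@eq_from_nth _ (mark0 A)); rewrite ste// => l le.
rewrite nth_take// nth_drop /e nth_take ?nth_drop; last by rewrite -se.
by have [] := step l; first by rewrite -ltnS -se.
Qed.

End Recognisability.
(** * Growth of the information of a word *)

Lemma words_bounded (R : realType) (A : finType) (F : seq A -> R) (M : nat) :
  exists K : R, forall u, (size u <= M)%N -> F u <= K.
Proof.
exists (\sum_(n < M.+1) \sum_(t : n.-tuple A) `|F t|) => u uM.
apply: le_trans (ler_norm _) _.
rewrite (bigD1 (Ordinal (uM : size u < M.+1)%N))//= (bigD1 (in_tuple u))//=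
  -addrA lerDl.
by rewrite addr_ge0// sumr_ge0// => *; rewrite sumr_ge0.
Qed.

(* The fixed point beta of the relation lam * beta = beta + L governs the growth
   of any G satisfying the renormalisation inequality. *)
Lemma renormalisation (R : realType) (A : finType) (lam L beta : R)
    (W : nat -> seq A -> Prop) (G : seq A -> R) :
  1 < lam -> beta * (lam - 1) = L ->
  (forall u, W 0 u -> (size u <= 1)%N) ->
  (forall delta, 0 < delta -> exists (N : nat) (C : R), forall k u,
     W k.+1 u -> (N <= size u)%N -> exists v,
     [/\ W k v, v != [::],
       `|lam * (size v)%:R - (size u)%:R| <= delta * (size u)%:R + C &
       G u <= G v + (L + delta) * (size v)%:R + C]) ->
  forall eps, 0 < eps -> exists C : R, forall k u, W k u -> u != [::] ->
    G u <= (beta + eps) * (size u)%:R + C.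
Proof.
move=> lam1 bL W0 step eps eps0.
have lam0 : 0 < lam by lra.
(* A slope error [eps] at [v] becomes [lam^-1 * eps] at [u]. The room gained is split into two
   halves [gam], one for the errors proportional to [delta] and one for the constants. *)
pose gam := eps * (1 - lam^-1) / 2.
have ilam : lam^-1 < 1 by rewrite invf_lt1.
have ilam0 : 0 < lam^-1 by rewrite invr_gt0.
have gam0 : 0 < gam by rewrite divr_gt0// mulr_gt0// subr_gt0.
(* [Q] will bound the total slope [c] below; [delta <= 1] accounts for its last summand. *)
pose Q := `|beta| + eps + 1.
have Q0 : 0 < Q by rewrite ltr_wpDl// addr_ge0// ltW.
pose delta := Num.min 1 (gam / (1 + Q)).
have Q1 : 0 < 1 + Q by rewrite addr_gt0.
have d0 : 0 < delta by rewrite /delta lt_min ltr01 divr_gt0.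
have d1 : delta <= 1 by rewrite /delta ge_min lexx.
have dQ : delta * (1 + Q) <= gam.
  by rewrite -ler_pdivlMr// /delta ge_min lexx orbT.
have [N [C stepC]] := step _ d0.
pose N' := Num.bound `|(1 + Q) * C / gam|.
(* Words too short for [gam * size u] to absorb [(1 + Q) * C] are finitely many, so one [K] handles
   them together with level 0; the induction hands on this same [K]. *)
have [K HK] := words_bounded (fun u : seq A =>
  G u - (beta + eps) * (size u)%:R) (N + N' + 2).
exists K; elim=> [|k IH] u Wu u0.
  have := HK u; rewrite (leq_trans (W0 _ Wu)); last by rewrite addn2.
  by move=> /(_ isT); lra.
have [le|lt] := leqP (size u) (N + N' + 2).
  by have := HK u le; lra.
have [v [Wv v0 sv Gv]] :=
  stepC _ _ Wu (ltnW (leq_ltn_trans (leq_trans (leq_addr _ _) (leq_addr _ _))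
  lt)).
have := IH _ Wv v0.
have gu : (1 + Q) * C <= gam * (size u)%:R.
  rewrite -ler_pdivrMl// mulrC.
  apply: le_trans (ler_norm _) _; apply: ltW.
  apply: lt_le_trans (archi_boundP (normr_ge0 _)) _.
  rewrite ler_nat; apply: leq_trans (ltnW lt).
  by rewrite -/N' addnAC leq_addl.
move: Gv sv gu; set V := (size v)%:R; set S := (size u)%:R => Gv sv gu IHv.
have S0 : 0 <= S by rewrite ler0n.
pose s := lam * V - S.
have VE : V = lam^-1 * (S + s) by rewrite /s; field; rewrite gt_eqF.
have sE : `|s| <= delta * S + C by [].
pose c := beta + lam^-1 * (eps + delta).
have main : G u <= c * S + c * s + C + K.
  apply: le_trans Gv _; apply: le_trans (lerD (lerD IHv (lexx _)) (lexx _)) _.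
  rewrite -bL le_eqVlt; apply/orP; left; apply/eqP.
  by rewrite VE /c; field; rewrite gt_eqF.
have ed0 : 0 < lam^-1 * (eps + delta) by rewrite mulr_gt0// addr_gt0.
have ed1 : lam^-1 * (eps + delta) <= eps + 1.
  apply: (@le_trans _ _ (eps + delta)); last by rewrite lerD2l.
  by rewrite ler_piMl ?ltW// addr_gt0.
have cQ : `|c| <= Q.
  apply: le_trans (ler_normD _ _) _; rewrite /Q -addrA lerD2l gtr0_norm//.
have cs : c * s <= Q * (delta * S + C).
  apply: le_trans (ler_norm _) _; rewrite normrM.
  by apply: ler_pM.
have cS : c * S <= (beta + lam^-1 * eps) * S + delta * S.
  rewrite -mulrDl ler_wpM2r// /c mulrDr addrA lerD2l ler_piMl// ltW//.
have dQS : delta * (1 + Q) * S <= gam * S by rewrite ler_wpM2r.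
have E : beta + lam^-1 * eps + gam + gam = beta + eps by rewrite /gam; field;
  rewrite gt_eqF.
have : (beta + eps) * S = (beta + lam^-1 * eps) * S + gam * S + gam * S.
  by rewrite -E; ring.
move: main cs cS dQS gu; rewrite !mulrDr !mulrDl !mulr1 !mul1r; lra.
Qed.

(** * Bounds on the information along families of words *)

Section InformationGrowth.
Context (R : realType) (A : alphabetType) (P : random_substitution R A).
Context (lam : R) (r : A -> R) (mu : probability (config A) R).
Hypothesis compat : compatible P.
Hypothesis PFr : PF_right_eigenvector P lam r.
Hypothesis lam1 : 1 < lam.
Hypothesis freq : frequency_measure P mu.
Hypothesis recog : recognisable P.

Local Notation B := (max_size P).
Local Notation info := (info P mu).

(* Q restricts the factors of the decodings which lead from W k.+1 to W k. *)
Definition family (W : nat -> seq A -> Prop) (Q : seq (A * seq A) -> Prop) :=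
  [/\ forall u, W 0 u -> (size u <= 1)%N,
      forall k u, W k u -> legal P u &
      forall k u, W k.+1 u -> exists d, [/\ valid P d, infix u (img d) &
        forall e, infix e d -> W k (src e) /\ Q e]].

Lemma info_upper W Q L : family W Q ->
  (forall delta, 0 < delta -> exists C : R, forall e, valid P e ->
     legal P (src e) -> Q e -> cost P e <= (L + delta) * (size e)%:R + C) ->
  forall eps, 0 < eps -> exists C : R, forall k u, W k u -> u != [::] ->
    info u <= (L / (lam - 1) + eps) * (size u)%:R + C.
Proof.
move=> [W0 Wl WS] costL; apply: (@renormalisation _ _ lam L) => //.
  by rewrite divfK// gt_eqF// subr_gt0.
move=> delta d0; have [C1 HC1] := costL _ d0.
have [C2 C20 HC2] := uniform_size_img compat PFr lam1 freq d0.
exists 1%N, (`|ln lam + C1| + (delta * (B.*2)%:R + C2 + (B.*2)%:R)) =>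
  k u Wu u1.
have u0 : u != [::] by rewrite -size_eq0 -lt0n.
have [d [vd ud dW]] := WS _ _ Wu.
have [e [x [y [ed e0 E xyB]]]] := tight compat vd ud u0.
have [We Qe] := dW _ ed; have ve := valid_infix ed vd; have le := Wl _ _ We.
have sz : (size (img e))%:R = (size u)%:R + (size x + size y)%:R :> R.
  by rewrite E !size_cat addnCA natrD.
have xy : (size x + size y)%:R <= (B.*2)%:R :> R by rewrite ler_nat.
have xy0 : 0 <= (size x + size y)%:R :> R by rewrite ler0n.
exists (src e); rewrite size_src; split=> //; first by case: (e) e0.
  have := HC2 e ve le; rewrite sz.
  have he : (size e)%:R <= (size u)%:R + (B.*2)%:R :> R.
    apply: (@le_trans _ _ (size (img e))%:R);
      first by rewrite ler_nat (size_img_ge compat ve).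
    by rewrite sz lerD2l.
  have hd : delta * (size e)%:R <= delta * (size u)%:R + delta * (B.*2)%:R.
    by rewrite -mulrDr ler_wpM2l// ltW.
  have := normr_ge0 (ln lam + C1).
  rewrite !ler_norml => ? /andP[? ?]; apply/andP; split; lra.
have := info_le compat PFr lam1 freq ve e0 u0 le E.
have := HC1 e ve le Qe; have := ler_norm (ln lam + C1).
have : 0 <= delta * (B.*2)%:R by rewrite mulr_ge0// ltW.
have : 0 <= (B.*2)%:R :> R by rewrite ler0n.
lra.
Qed.

(** This is renormalisation for [- info] and [- L]. The covering decoding used for the upper bound
    is replaced by one trimmed to the inside of [u], for which [info_ge] is available. *)
Lemma info_lower W Q L : family W Q ->
  (forall delta, 0 < delta -> exists C : R, forall e, valid P e ->
     legal P (src e) -> Q e -> (L - delta) * (size e)%:R - C <= cost P e) ->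
  forall eps, 0 < eps -> exists C : R, forall k u, W k u -> u != [::] ->
    (L / (lam - 1) - eps) * (size u)%:R - C <= info u.
Proof.
move=> [W0 Wl WS] costL eps eps0.
have [M HM] := recognisable_trim compat recog.
suff [C HC] : exists C : R, forall k u, W k u -> u != [::] ->
    - info u <= (- L / (lam - 1) + eps) * (size u)%:R + C.
  exists C => k u Wu u0; have := HC _ _ Wu u0; lra.
move: eps eps0; apply: (@renormalisation _ _ lam (- L)) => //.
  by rewrite divfK// gt_eqF// subr_gt0.
move=> delta d0; have [C1 HC1] := costL _ d0.
have [C2 C20 HC2] := uniform_size_img compat PFr lam1 freq d0.
exists (M + 1)%N, (`|C1 - ln lam| + C2 + M%:R) => k u Wu uM.
have u0 : u != [::] by rewrite -size_eq0 -lt0n; apply: leq_trans uM;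
  rewrite addn1.
have [d [vd ud dW]] := WS _ _ Wu.
have ld : legal P (src d) by apply: Wl; exact: (dW _ (infix_refl _)).1.
have [e [ed e0 s1 s2 H]] := HM _ _ vd ld ud (leq_trans (leq_addr _ _) uM).
have [We Qe] := dW _ ed; have ve := valid_infix ed vd; have le := Wl _ _ We.
rewrite -(ler_nat R) natrD in s1; rewrite -(ler_nat R) in s2.
exists (src e); rewrite size_src; split=> //; first by case: (e) e0.
  have := HC2 e ve le.
  have he : (size e)%:R <= (size u)%:R :> R.
    by apply: le_trans s2; rewrite ler_nat (size_img_ge compat ve).
  have hd : delta * (size e)%:R <= delta * (size u)%:R
    by rewrite ler_wpM2l// ltW.
  have := normr_ge0 (C1 - ln lam).
  rewrite !ler_norml => ? /andP[? ?]; apply/andP; split; lra.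
have := info_ge compat PFr lam1 freq ve e0 u0 (Wl _ _ Wu) le H.
have := HC1 e ve le Qe; have := ler_norm (C1 - ln lam).
have : 0 <= M%:R :> R by rewrite ler0n.
lra.
Qed.

Lemma family_level : family (level P) (fun _ => True).
Proof.
split=> [u [a [w [r0 uw]]]|k u /level_legal//|k u].
  by move: r0 uw; rewrite reach0 => /eqP -> /size_infix.
move=> /levelSP[d [vd ld ud]]; exists d; split=> // e ed; split=> //.
by apply: level_infix ld; apply: src_infix.
Qed.

Definition letter_info p : R := - ln (rs_prob P p.1 p.2).

Lemma costE e : valid P e -> cost P e = \sum_(p <- e) letter_info p.
Proof. exact: cost_sum. Qed.

Lemma rs_prob_le1 a s : s \in rs_img P a -> rs_prob P a s <= 1.
Proof.
move=> sa; rewrite -(rs_prob_sum P a) (bigD1_seq s) ?fset_uniq//= lerDl.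
rewrite big_seq_cond sumr_ge0// => t /andP[ta _].
exact: ltW (rs_prob_gt0 ta).
Qed.

Lemma big_attained (op : R -> R -> R) (x0 : R) (s : seq (seq A)) (F : seq A ->
  R) :
  (forall x y, op x y = x \/ op x y = y) ->
  \big[op/x0]_(t <- s) F t = x0 \/ exists2 t,
    t \in s & \big[op/x0]_(t <- s) F t = F t.
Proof.
move=> opP; elim: s => [|t s IH]; first by rewrite big_nil; left.
rewrite big_cons; set b := \big[op/x0]_(_ <- s) _ in IH *.
have [->|->] := opP (F t) b; first by right; exists t; rewrite ?mem_head.
by case: IH => [|[v vs E]]; [left|right; exists v; rewrite ?in_cons ?vs ?orbT].
Qed.

Lemma max_prob_ge a s : s \in rs_img P a -> rs_prob P a s <= max_prob P a.
Proof. by move=> sa; rewrite /max_prob; apply: le_bigmax_seq. Qed.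

Lemma min_prob_le a s : s \in rs_img P a -> min_prob P a <= rs_prob P a s.
Proof. by move=> sa; rewrite /min_prob; apply: ge_bigmin_seq. Qed.

Lemma max_prob_attained a : exists2 s,
  s \in rs_img P a & rs_prob P a s = max_prob P a.
Proof.
have [|E|[s sa E]] := @big_attained Num.max 0 (rs_img P a) (rs_prob P a).
- by move=> x y; rewrite /Num.max; case: ifP; [right|left].
- have b := block0P P a; have := max_prob_ge b; rewrite /max_prob E.
  by rewrite leNgt (rs_prob_gt0 b).
- by exists s.
Qed.

Lemma min_prob_attained a : exists2 s,
  s \in rs_img P a & rs_prob P a s = min_prob P a.
Proof.
have [|E|[s sa E]] := @big_attained Num.min 1 (rs_img P a) (rs_prob P a).
- by move=> x y; rewrite /Num.min; case: ifP; [left|right].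
(* If the minimum equals the default value 1, then [block0 P a] has probability 1 and attains it. *)
- have b := block0P P a; have := min_prob_le b; rewrite /min_prob E => ge1.
  by exists (block0 P a) => //; apply/eqP; rewrite eq_le ge1 rs_prob_le1.
- by exists s.
Qed.

Definition cmin a : R := - ln (max_prob P a).
Definition cmax a : R := - ln (min_prob P a).

Lemma max_prob_gt0 a : 0 < max_prob P a.
Proof. by have [s sa <-] := max_prob_attained a; apply: rs_prob_gt0 sa. Qed.

Lemma min_prob_gt0 a : 0 < min_prob P a.
Proof. by have [s sa <-] := min_prob_attained a; apply: rs_prob_gt0 sa. Qed.

Lemma letter_info_bounds p : p.2 \in rs_img P p.1 ->
  cmin p.1 <= letter_info p <= cmax p.1.
Proof.
move=> sa; rewrite /letter_info /cmin /cmax !lerN2 !ler_ln ?posrE.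
- by rewrite max_prob_ge// min_prob_le.
- exact: min_prob_gt0.
- exact: rs_prob_gt0 sa.
- exact: rs_prob_gt0 sa.
- exact: max_prob_gt0.
Qed.

Lemma cmin_ge0 a : 0 <= cmin a.
Proof.
have [s sa E] := max_prob_attained a.
by rewrite /cmin oppr_ge0 ln_le0// -E rs_prob_le1.
Qed.

Lemma cmin_le_max a : cmin a <= cmax a.
Proof.
have [s sa _] := max_prob_attained a.
by have /andP[] := @letter_info_bounds (a, s) sa; apply: le_trans.
Qed.

Definition dim_of (h : A -> R) := (\sum_a r a * h a) / (lam - 1).

Lemma info_le_max eps : 0 < eps -> exists C : R, forall u, legal P u ->
  u != [::] ->
  info u <= (dim_of cmax + eps) * (size u)%:R + C.
Proof.
move=> eps0; have [|C HC] := info_upper (L :=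
  \sum_a r a * cmax a) family_level _ eps0.
  move=> delta d0; have [C C0 HC] := uniform_sum compat PFr lam1 freq cmax d0.
  exists C => e ve le _; rewrite costE//.
  apply: (@le_trans _ _ (\sum_(p <- e) cmax p.1)).
    rewrite !big_seq; apply: ler_sum => p pe.
    by have /andP[] := letter_info_bounds (allP ve p pe).
  have := HC _ le; rewrite size_src big_map ler_norml => /andP[_]; lra.
by exists C => u /legalP[k ku]; apply: HC ku.
Qed.

Lemma info_ge_min eps : 0 < eps -> exists C : R, forall u, legal P u ->
  u != [::] ->
  (dim_of cmin - eps) * (size u)%:R - C <= info u.
Proof.
move=> eps0; have [|C HC] := info_lower (L :=
  \sum_a r a * cmin a) family_level _ eps0.
  move=> delta d0; have [C C0 HC] := uniform_sum compat PFr lam1 freq cmin d0.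
  exists C => e ve le _; rewrite costE//.
  apply: (@le_trans _ _ (\sum_(p <- e) cmin p.1)).
    have := HC _ le; rewrite size_src big_map ler_norml => /andP[+ _]; lra.
  rewrite !big_seq; apply: ler_sum => p pe.
  by have /andP[] := letter_info_bounds (allP ve p pe).
by exists C => u /legalP[k ku]; apply: HC ku.
Qed.

(** * Words and points of prescribed average cost *)

Section Balanced.
Context (h : A -> R).
Hypothesis h_bounds : forall a, cmin a <= h a <= cmax a.

Local Notation D := (\sum_a cmax a).
Local Notation excess e := (\sum_(p <- e) (letter_info p - h p.1)).

Lemma cmax_le_sum a : 0 <= cmax a <= D.
Proof.
have c0 b : 0 <= cmax b by apply: le_trans (cmin_ge0 b) (cmin_le_max b).
by rewrite c0 (bigD1 a)//= lerDl sumr_ge0.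
Qed.

(* Choosing the least likely block when the accumulated excess is nonpositive,
   and the most likely one otherwise, keeps the excess bounded. *)
Lemma balanced_decoding_from (x : R) w : - D <= x <= D -> exists d,
  [/\ valid P d, src d = w &
      forall l, - D <= x + excess (take l d) <= D].
Proof.
elim: w x => [|a w IH] x xD.
  by exists [::]; split=> // l; rewrite big_nil addr0.
have /andP[c0 cD] := cmax_le_sum a; have m0 := cmin_ge0 a.
have /andP[h1 h2] := h_bounds a.
have [s sa xs] : exists2 s, s \in rs_img P a &
    - D <= x + (letter_info (a, s) - h a) <= D.
  have [x0|x0] := lerP x 0.
    have [s sa E] := min_prob_attained a; exists s => //.
    by rewrite /letter_info E -/(cmax a); lra.
  have [s sa E] := max_prob_attained a; exists s => //.
  by rewrite /letter_info E -/(cmin a); lra.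
have [d [vd dw dP]] := IH _ xs.
exists ((a, s) :: d); split=> [||[|l]] /=.
- by rewrite sa.
- by rewrite dw.
- by rewrite big_nil addr0.
- by rewrite big_cons addrA.
Qed.

(** A factor is the difference of two prefixes, each with excess between [- D] and [D]; hence the
    bound [2 * D], the same for all factors. *)
Lemma balanced_decoding w : exists d, [/\ valid P d, src d = w &
  forall e, infix e d -> `|excess e| <= 2 * D].
Proof.
have D0 : 0 <= D by have /andP[] := cmax_le_sum point; apply: le_trans.
have [|d [vd dw dP]] := @balanced_decoding_from 0 w; first lra.
exists d; split=> // e /infixP[x [y E]].
have := dP (size x); have := dP (size (x ++ e)).
rewrite E catA take_size_cat// -catA take_size_cat// big_cat /= ler_norml; lra.
Qed.

Definition balanced w := sval (cid (balanced_decoding w)).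

Lemma balancedP w : [/\ valid P (balanced w), src (balanced w) = w &
  forall e, infix e (balanced w) -> `|excess e| <= 2 * D].
Proof. by rewrite /balanced; case: cid. Qed.

(** Each word is the image of the chosen decoding of the previous one, so factors at one level
    desubstitute to factors at the level below, as a [family] demands. *)
Definition balanced_word k a : seq A := iter k (fun w =>
  img (balanced w)) [:: a].

Definition balanced_level k u := exists a, infix u (balanced_word k a).

Lemma balanced_reach k a : reach P k [:: a] (balanced_word k a).
Proof.
elim: k => [|k IH]; first by rewrite reach0.
have [vd ds _] := balancedP (balanced_word k a).
by apply/reachSP; exists (balanced (balanced_word k a)); split=> //; rewrite ds.
Qed.

Lemma family_balanced : family balanced_level (fun e => `|excess e| <= 2 * D).
Proof.
split=> [u [a /size_infix//]|k u [a ua]|k u [a ua]].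
  by apply/legalP; exists k, a, (balanced_word k a); split=> //;
    apply: balanced_reach.
have [vd ds dP] := balancedP (balanced_word k a).
exists (balanced (balanced_word k a)); split=> // e ed; split; last exact: dP.
by exists a; rewrite -[X in infix _ X]ds; apply: src_infix.
Qed.

Lemma balanced_cost delta : 0 < delta -> exists C : R, forall e, valid P e ->
  legal P (src e) -> `|excess e| <= 2 * D ->
  `|cost P e - (\sum_a r a * h a) * (size e)%:R| <= delta * (size e)%:R + C.
Proof.
move=> d0; have [C C0 HC] := uniform_sum compat PFr lam1 freq h d0.
exists (C + 2 * D) => e ve le; rewrite costE// sumrB => ex.
have := HC _ le; rewrite size_src big_map => hl.
rewrite [X in `|X|](_ : _ = \sum_(p <- e) letter_info p - \sum_(p <- e) h p.1 +
  (\sum_(p <- e) h p.1 - (\sum_a r a * h a) * (size e)%:R)); last by ring.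
apply: le_trans (ler_normD _ _) _; lra.
Qed.

Lemma balanced_info eps : 0 < eps -> exists C : R, forall k u,
  balanced_level k u -> u != [::] ->
  `|info u - dim_of h * (size u)%:R| <= eps * (size u)%:R + C.
Proof.
move=> eps0.
have [|C1 HC1] := info_upper (L := \sum_a r a * h a) family_balanced _ eps0.
  move=> delta d0; have [C HC] := balanced_cost d0; exists C => e ve le Qe.
  by have := HC e ve le Qe; rewrite ler_norml => /andP[_]; lra.
have [|C2 HC2] := info_lower (L := \sum_a r a * h a) family_balanced _ eps0.
  move=> delta d0; have [C HC] := balanced_cost d0; exists C => e ve le Qe.
  by have := HC e ve le Qe; rewrite ler_norml => /andP[+ _]; lra.
exists (`|C1| + `|C2|) => k u ku u0.
have := HC1 k u ku u0; have := HC2 k u ku u0; rewrite -/(dim_of h).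
have := ler_norm C1; have := ler_norm C2; have := normr_ge0 C1;
  have := normr_ge0 C2.
rewrite ler_norml => *; apply/andP; split; lra.
Qed.

(** By compatibility the letter counts are not random: the expected count is the count in every word
    that can be reached. *)
Lemma count_reach k a b w : reach P k [:: a] w ->
  (count_mem b w)%:R = letters P k a b.
Proof.
elim: k b w => [|k IH] b w.
  by rewrite reach0 => /eqP ->; rewrite letters0 /= addn0.
move=> /reachSP[d [vd rd <-]];
  rewrite (count_img compat b vd) lettersS// natr_sum.
by apply: eq_bigr => c _; rewrite natrM (IH _ _ rd).
Qed.

Lemma size_reach k a w : reach P k [:: a] w -> (size w)%:R = len P k a.
Proof.
move=> rw; rewrite size_sum_count natr_sum lenE.
by apply: eq_bigr => b _; rewrite (count_reach b rw).
Qed.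

(** The lengths at step [k], averaged with the weights [r], equal [lam ^+ k]; once this is at least
    [n], so is the length for some letter. *)
Lemma balanced_word_long n : exists ka : nat * A,
  (n <= size (balanced_word ka.1 ka.2))%N.
Proof.
have [k kn] : exists k, n%:R <= lam ^+ k.
  pose t := lam - 1; have t0 : 0 < t by rewrite subr_gt0.
  exists (Num.bound (n%:R / t)).
  (* A form of Bernoulli's inequality for [lam = 1 + t]. *)
  have bern k : k%:R * t <= lam ^+ k.
    elim: k => [|k IH]; first by rewrite mul0r expr0.
    have l1 : 1 <= lam ^+ k by rewrite exprn_ege1// ltW.
    have -> : lam ^+ k.+1 = lam ^+ k + t * lam ^+ k by rewrite exprS /t; ring.
    by rewrite -natr1 mulrDl mul1r lerD// ler_peMr// ltW.
  apply: le_trans (bern _); rewrite -ler_pdivrMr//; apply: ltW.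
  by apply: archi_boundP; rewrite divr_ge0// ltW.
apply: contrapT => /forallNP H.
have : lam ^+ k < n%:R.
  have -> : n%:R = \sum_a r a * n%:R by rewrite -mulr_suml (r_sum PFr) mul1r.
  rewrite -(r_len compat PFr).
  apply: ltr_sum => [|a _]; first by apply/hasP; exists point => //;
    rewrite mem_index_enum.
  rewrite ltr_pM2l ?(r_gt0 PFr)// -(size_reach (balanced_reach k a)) ltr_nat
    ltnNge.
  by apply/negP; exact: (H (k, a)).
by rewrite ltNge kn.
Qed.

Lemma balanced_point : exists x, subshift P x /\ forall eps, 0 < eps ->
  exists C : R, forall i n, (0 < n)%N ->
    `|info (subword x i n) - dim_of h * n%:R| <= eps * n%:R + C.
Proof.
have [ka kaP] := choice (fun n => balanced_word_long (n.*2.+1)).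
pose w n := balanced_word (ka n).1 (ka n).2.
have [U [UU Uoo]] := nat_ultrafilter.
(* The letter of index [n] in [w n] is taken as origin; the length, at least [n.*2.+1], leaves [n]
   letters on either side of it. *)
have ex (i : int) : exists a : A,
  U [set n | nth (letter0 A) (w n) (absz (n%:Z + i)) = a].
  apply: (@ultra_limit _ U _ (enum A)) => //.
  by apply: filterS filterT => k _ /=; rewrite mem_enum.
have [x xP] := choice ex.
have FU : Filter U by apply: filter_filter.
have win i n : exists k, balanced_level k (subword x i n).
  have H := filter_ltn (FU := FU) (n := n) (F := fun m k =>
    nth (letter0 A) (w k) (absz (k%:Z + (i + m%:Z))) = x (i + m%:Z)) (fun m _
      => xP _).
  have [k /= [kx kn]] := filter_ex (filterI H (Uoo (absz i + n)%N)).
  have wk : (k.*2 < size (w k))%N := kaP k.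
  exists (ka k).1, (ka k).2; rewrite -/(w k).
  rewrite (@subwordE _ x i n (w k) (absz (k%:Z + i))).
  - exact: infix_trans (infix_take _ _) (infix_drop _ _).
  - by lia.
  - by move=> m mn; rewrite -kx//; congr nth; lia.
have [_ bl _] := family_balanced.
exists x; split=> [i n|eps eps0].
  by have [k kw] := win i n; apply: bl kw.
have [C HC] := balanced_info eps0; exists C => i n n0.
have [k kw] := win i n; have := HC k _ kw; rewrite size_subword; apply.
by rewrite -size_eq0 size_subword -lt0n.
Qed.

End Balanced.
End InformationGrowth.
(** * The multifractal spectrum *)

Section LimitsInferiorSuperior.
Context (R : realType).
Local Open Scope ereal_scope.
Implicit Types (u : (\bar R)^nat) (b : \bar R).

Lemma limn_einf_ge u b : (\forall n \near \oo, b <= u n) -> b <= limn_einf u.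
Proof.
move=> [N _ H]; rewrite limn_einf_lim.
apply: lime_ge; first exact: is_cvg_einfs.
exists N => // n /= Nn; apply: le_ereal_inf_tmp => _ [k /= nk <-].
by apply: H; apply: leq_trans nk.
Qed.

(* N n is the length of the word measured at step n. *)
Lemma limn_einf_ge_linear u (N : nat -> nat) (g : nat -> R) (a : R) :
  (forall n, (n <= N n)%N) ->
  (forall n, (0 < n)%N -> u n = (g n / (N n)%:R)%:E) ->
  (forall eps : R, (0 < eps)%R -> exists C : R, forall n, (0 < n)%N ->
    ((a - eps) * (N n)%:R - C <= g n)%R) ->
  a%:E <= limn_einf u.
Proof.
move=> nN uE H; apply/lee_addgt0Pr => eps eps0.
rewrite -leeBlDr// -EFinB; apply: limn_einf_ge.
(* Half of [eps] is spent on the slope, the other half absorbs the constant [C] once [n] is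
   large. *)
have e20 : (0 < eps / 2)%R by rewrite divr_gt0.
have [C HC] := H _ e20.
exists (Num.bound `|C / (eps / 2)|%R).+1 => // n /= nC.
have n0 : (0 < n)%N by apply: leq_trans nC.
have N0 : (0 < (N n)%:R :> R)%R by rewrite ltr0n (leq_trans n0).
rewrite uE// lee_fin ler_pdivlMr//; apply: le_trans (HC n n0).
have : (C <= eps / 2 * (N n)%:R)%R.
  rewrite mulrC -ler_pdivrMr//; apply: le_trans (ler_norm _) _.
  apply: ltW; apply: lt_le_trans (archi_boundP (normr_ge0 _)) _.
  by rewrite ler_nat; apply: leq_trans (nN n); apply: ltnW.
lra.
Qed.

Lemma limn_esup_le_linear u (N : nat -> nat) (g : nat -> R) (a : R) :
  (forall n, (n <= N n)%N) ->
  (forall n, (0 < n)%N -> u n = (g n / (N n)%:R)%:E) ->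
  (forall eps : R, (0 < eps)%R -> exists C : R, forall n, (0 < n)%N ->
    (g n <= (a + eps) * (N n)%:R + C)%R) ->
  limn_esup u <= a%:E.
Proof.
move=> nN uE H; rewrite -[limn_esup u]oppeK -limn_einfN leeNl -EFinN.
apply: (@limn_einf_ge_linear _ N (fun n => - g n)%R) => // [n n0 /=|eps eps0].
  by rewrite uE// -EFinN mulNr.
have [C HC] := H _ eps0; exists C => n n0; have := HC n n0; lra.
Qed.

End LimitsInferiorSuperior.

(** * Local dimensions and asymptotics of [tau] *)

Section Multifractal.
Context (R : realType) (A : alphabetType) (P : random_substitution R A).
Context (lam : R) (r : A -> R) (mu : probability (config A) R).
Hypothesis compat : compatible P.
Hypothesis PFr : PF_right_eigenvector P lam r.
Hypothesis lam1 : 1 < lam.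
Hypothesis freq : frequency_measure P mu.
Hypothesis recog : recognisable P.

Local Notation info := (info P mu).
Local Notation f := (freq_of P mu).

Lemma local_dim_seqE x n : subshift P x ->
  local_dim_seq P mu x n =
  (info (subword x (- n%:Z) n.*2.+1) / (n.*2.+1)%:R)%:E.
Proof.
move=> xX; rewrite /local_dim_seq (mu_central_cylinder freq) lne_EFin;
  last first.
  by apply: (freq_gt0 compat PFr lam1 freq) => //; exact: xX.
by rewrite -EFinN -EFinM /info mulrC mulrN mulNr.
Qed.

Lemma lower_local_dim_ge x (a : R) : subshift P x ->
  (forall eps, 0 < eps -> exists C : R, forall i n, (0 < n)%N ->
    (a - eps) * n%:R - C <= info (subword x i n)) ->
  (a%:E <= lower_local_dim P mu x)%E.
Proof.
move=> xX H; apply: (@limn_einf_ge_linear _ _ (fun n => n.*2.+1)).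
- by move=> n; lia.
- by move=> n _; exact: local_dim_seqE.
- by move=> eps /H[C HC]; exists C => n _; apply: HC.
Qed.

Lemma upper_local_dim_le x (a : R) : subshift P x ->
  (forall eps, 0 < eps -> exists C : R, forall i n, (0 < n)%N ->
    info (subword x i n) <= (a + eps) * n%:R + C) ->
  (upper_local_dim P mu x <= a%:E)%E.
Proof.
move=> xX H; apply: (@limn_esup_le_linear _ _ (fun n => n.*2.+1)).
- by move=> n; lia.
- by move=> n _; exact: local_dim_seqE.
- by move=> eps /H[C HC]; exists C => n _; apply: HC.
Qed.

Lemma subword_neq_nil (x : int -> A) i n : (0 < n)%N -> subword x i n != [::].
Proof. by rewrite -size_eq0 size_subword -lt0n. Qed.

Lemma local_dim_bounds x : subshift P x ->
  [/\ ((dim_of lam r (cmin P))%:E <= lower_local_dim P mu x)%E,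
      (lower_local_dim P mu x <= upper_local_dim P mu x)%E &
      (upper_local_dim P mu x <= (dim_of lam r (cmax P))%:E)%E].
Proof.
move=> xX; split; last 1 first.
- apply: upper_local_dim_le => // eps eps0.
  have [C HC] := info_le_max compat PFr lam1 freq eps0.
  exists C => i n n0; have := HC _ (xX i n) (subword_neq_nil x i n0).
  by rewrite size_subword.
- apply: lower_local_dim_ge => // eps eps0.
  have [C HC] := info_ge_min compat PFr lam1 freq recog eps0.
  exists C => i n n0; have := HC _ (xX i n) (subword_neq_nil x i n0).
  by rewrite size_subword.
- exact: limn_einf_sup.
Qed.

Lemma local_dim_attained (h : A ->
  R) : (forall a, cmin P a <= h a <= cmax P a) ->
  exists2 x, subshift P x & has_local_dim P mu x (dim_of lam r h)%:E.
Proof.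
move=> hb; have [x [xX H]] := balanced_point compat PFr lam1 freq recog hb.
exists x => //.
have lo : ((dim_of lam r h)%:E <= lower_local_dim P mu x)%E.
  apply: lower_local_dim_ge => // eps /H[C HC]; exists C => i n /(HC i).
  by rewrite ler_norml => /andP[+ _]; lra.
have hi : (upper_local_dim P mu x <= (dim_of lam r h)%:E)%E.
  apply: upper_local_dim_le => // eps /H[C HC]; exists C => i n /(HC i).
  by rewrite ler_norml => /andP[_]; lra.
have mid : (lower_local_dim P mu x <= upper_local_dim P mu x)%E :=
  limn_einf_sup _.
split; apply/eqP; rewrite eq_le.
- by rewrite lo (le_trans mid hi).
- by rewrite hi (le_trans lo mid).
Qed.

Definition partition_sum q n : R :=
  \sum_(u : n.-tuple A | `[< legal P u >]) expR (- q * info u).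

Lemma tau_seqE q n : (0 < n)%N ->
  (exists u : n.-tuple A, legal P u) ->
  (- ((n%:R : R)^-1)%:E *
   lne (\sum_(u : n.-tuple A | `[< legal P u >]) poweR (mu (cylinder P u)) q))%E
  = (- ln (partition_sum q n) / n%:R)%:E.
Proof.
move=> n0 [u0 lu0].
have -> : (\sum_(u : n.-tuple A
  | `[< legal P u >]) poweR (mu (cylinder P u)) q)%E =
    (partition_sum q n)%:E.
  rewrite /partition_sum -sumEFin; apply: eq_bigr => u /asboolP lu.
  rewrite (freq_ofE P mu) poweR_EFin /powR gt_eqF; last first.
    apply: (freq_gt0 compat PFr lam1 freq) => //.
    by rewrite -size_eq0 size_tuple -lt0n.
  by rewrite /info mulrNN.
rewrite lne_EFin; first by rewrite -EFinN -EFinM mulrC mulrN mulNr.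
rewrite /partition_sum (bigD1 u0)/=; last exact/asboolP.
by rewrite ltr_pwDl ?expR_gt0// sumr_ge0// => u _; rewrite expR_ge0.
Qed.

(** The partition sum has at most [#|A| ^ n] terms, each controlled by the first hypothesis, and it
    dominates the single term given by the point [x]. The two estimates differ by [ln #|A|] per
    letter. *)
Lemma tau_bounds q al :
  (forall eps, 0 < eps -> exists C : R, forall u, legal P u -> u != [::] ->
     - q * info u <= (- (q * al) + eps) * (size u)%:R + C) ->
  (exists x, subshift P x /\ forall eps, 0 < eps -> exists C : R,
     forall n, (0 < n)%N ->
     (- (q * al) - eps) * n%:R - C <= - q * info (subword x 0 n)) ->
  ((q * al - ln #|A|%:R)%:E <= tau P mu q <= (q * al)%:E)%E.
Proof.
move=> Hle [x [xX Hge]].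
have lx n : exists u : n.-tuple A, legal P u.
  exists (tcast (size_subword x 0 n) (in_tuple (subword x 0 n))).
  by rewrite val_tcast; apply: xX.
have A0 : 0 < #|A|%:R :> R by rewrite ltr0n; apply/card_gt0P; exists point.
have S0 n : 0 < partition_sum q n.
  have [u0 lu0] := lx n; rewrite /partition_sum (bigD1 u0)/=;
    last exact/asboolP.
  by rewrite ltr_pwDl ?expR_gt0// sumr_ge0// => u _; rewrite expR_ge0.
rewrite /tau; apply/andP; split.
  apply: (@limn_einf_ge_linear _ _ id (fun n => - ln (partition_sum q n))) =>
    //.
    by move=> n n0; apply: tau_seqE.
  move=> eps /Hle[C HC]; exists C => n n0.
  have : partition_sum q n <= #|A|%:R ^+ n * expR ((- (q * al) + eps) * n%:R +
    C).
    apply: (@le_trans _ _ (\sum_(u : n.-tuple A) expR ((- (q * al) + eps) *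
      n%:R + C))).
      rewrite /partition_sum [leLHS]big_mkcond /=; apply: ler_sum => u _.
      case: asboolP => [lu|_]; last exact: expR_ge0.
      rewrite ler_expR; have := HC u lu; rewrite size_tuple; apply.
      by rewrite -size_eq0 size_tuple -lt0n.
    by rewrite sumr_const card_tuple -natrX [leRHS]mulr_natl.
  rewrite -ler_ln ?posrE ?mulr_gt0 ?exprn_gt0 ?expR_gt0//.
  rewrite lnM ?posrE ?exprn_gt0 ?expR_gt0// expRK lnXn// -mulr_natr; lra.
apply: le_trans (limn_einf_sup _) _.
apply: (@limn_esup_le_linear _ _ id (fun n => - ln (partition_sum q n))) => //.
  by move=> n n0; apply: tau_seqE.
move=> eps /Hge[C HC]; exists C => n n0.
pose u0 := tcast (size_subword x 0 n) (in_tuple (subword x 0 n)).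
have u0E : tval u0 = subword x 0 n by rewrite val_tcast.
have : expR ((- (q * al) - eps) * n%:R - C) <= partition_sum q n.
  rewrite /partition_sum (bigD1 u0)/=; last by apply/asboolP; rewrite u0E;
    apply: xX.
  apply: ler_wpDr; first by rewrite sumr_ge0// => u _; exact: expR_ge0.
  by rewrite ler_expR u0E HC.
by rewrite -ler_ln ?posrE ?expR_gt0// expRK; lra.
Qed.

Lemma dist_div_le q al c (t : \bar R) : q != 0 -> 0 <= c ->
  ((q * al - c)%:E <= t <= (q * al)%:E)%E ->
  ((t * (q^-1)%:E) \is a fin_num)%E /\
  `|al - fine (t * (q^-1)%:E)%E| <= c / `|q|.
Proof.
move=> q0 c0; case: t => [t| |]; last 2 first.
- by rewrite leye_eq /= andbF.
- by rewrite leeNy_eq /=.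
rewrite !lee_fin => /andP[h1 h2]; split=> //=.
have nq : 0 < `|q| by rewrite normr_gt0.
rewrite ler_pdivlMr// -normrM (_ : _ * q = q * al - t); last by field.
by rewrite ger0_norm; lra.
Qed.

(** For positive [q] the words of least information dominate, and balancing with [h = cmin] yields a
    point all of whose subwords are of this kind. *)
Lemma tau_max q : 0 < q ->
  ((q * dim_of lam r (cmin P) - ln #|A|%:R)%:E <= tau P mu q <=
   (q * dim_of lam r (cmin P))%:E)%E.
Proof.
move=> q0; apply: tau_bounds => [eps eps0|].
  have [C HC] := info_ge_min compat PFr lam1 freq recog (divr_gt0 eps0 q0).
  exists (q * C) => u lu u0; have := HC u lu u0; rewrite -(ler_pM2l q0).
  rewrite mulrBr mulrA mulrBr [q * (eps / q)]mulrC divfK ?gt_eqF//; lra.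
have [|x [xX H]] := @balanced_point _ _ _ _ _ _ compat PFr lam1 freq recog
  (cmin P).
  by move=> a; rewrite lexx cmin_le_max.
exists x; split=> // eps eps0; have [C HC] := H _ (divr_gt0 eps0 q0).
exists (q * C) => n n0; have := HC 0 n n0; rewrite ler_norml => /andP[_].
rewrite -(ler_pM2l q0) mulrBr [leRHS]mulrDr !mulrA [q * eps / q]mulrAC divff
  ?gt_eqF//; lra.
Qed.

(** For negative [q] the order is reversed: the words of most information dominate, and [h = cmax]
    provides the point. *)
Lemma tau_min q : q < 0 ->
  ((q * dim_of lam r (cmax P) - ln #|A|%:R)%:E <= tau P mu q <=
   (q * dim_of lam r (cmax P))%:E)%E.
Proof.
move=> q0; have nq : 0 < - q by rewrite oppr_gt0.
apply: tau_bounds => [eps eps0|].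
  have [C HC] := info_le_max compat PFr lam1 freq (divr_gt0 eps0 nq).
  exists (- q * C) => u lu u0; have := HC u lu u0; rewrite -(ler_pM2l nq).
  rewrite mulrDr mulrA mulrDr [- q * (eps / - q)]mulrC divfK ?gt_eqF//; lra.
have [|x [xX H]] := @balanced_point _ _ _ _ _ _ compat PFr lam1 freq recog
  (cmax P).
  by move=> a; rewrite lexx cmin_le_max.
exists x; split=> // eps eps0; have [C HC] := H _ (divr_gt0 eps0 nq).
exists (- q * C) => n n0; have := HC 0 n n0; rewrite ler_norml => /andP[+ _].
rewrite -(ler_pM2l nq) mulrBr mulrN [X in - X <= _]mulrDr !mulrA.
rewrite [- q * eps / - q]mulrAC divff ?gt_eqF//; lra.
Qed.

End Multifractal.

(** Primitivity only asserts that some Perron--Frobenius eigenvalue exceeds 1; maximality of the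
    modulus transfers this to the given [lam]. *)
Lemma PF_eigenvalue_le (R : realType) n (M : 'M[R]_n) (lam lam' : R) :
  PF_eigenvalue M lam -> eigenvalue M lam' -> lam' <= lam.
Proof.
move=> [_ maxi]; rewrite -(eigenvalue_map (real_complex R)) => /maxi.
rewrite normc_def lecR /= expr0n addr0 sqrtr_sqr; exact: le_trans (ler_norm _).
Qed.
Theorem corollaryE (R : realType) (A : alphabetType)
    (P : random_substitution R A) (lam : R) (r : A -> R)
    (mu : probability (config A) R) :
  primitive P -> compatible P -> recognisable P ->
  PF_eigenvalue (subst_matrix P) lam ->
  PF_right_eigenvector P lam r ->
  frequency_measure P mu ->
  let alpha_min := - (lam - 1)^-1 * \sum_(a : A) r a * ln (max_prob P a) in
  let alpha_max := - (lam - 1)^-1 * \sum_(a : A) r a * ln (min_prob P a) in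
  [/\ (tau P mu q * (q^-1)%:E)%E @[q --> +oo] --> alpha_min%:E,
      (tau P mu q * (q^-1)%:E)%E @[q --> -oo] --> alpha_max%:E,
      forall x : int -> A, subshift P x ->
        [/\ (alpha_min%:E <= lower_local_dim P mu x)%E,
            (lower_local_dim P mu x <= upper_local_dim P mu x)%E &
            (upper_local_dim P mu x <= alpha_max%:E)%E] &
      [set d | exists2 x, subshift P x & has_local_dim P mu x d] =
        [set d%:E | d in `[alpha_min, alpha_max]]].
Proof.
move=> [_ [lam' [lam'_eig _] lam'1]] compat recog PFlam PFr freq alpha_min
  alpha_max.
have lam1 : 1 < lam := lt_le_trans lam'1 (PF_eigenvalue_le PFlam lam'_eig).
have sumN (p : A -> R) : dim_of lam r (fun a => - ln (p a)) =
    - (lam - 1)^-1 * \sum_a r a * ln (p a).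
  rewrite /dim_of mulNr mulrC -mulrN -sumrN; congr (_ * _).
  by apply: eq_bigr => a _; rewrite mulrN.
have aminE : alpha_min = dim_of lam r (cmin P) by rewrite [RHS]sumN.
have amaxE : alpha_max = dim_of lam r (cmax P) by rewrite [RHS]sumN.
have lnA0 : 0 <= ln #|A|%:R :> R.
  by rewrite ln_ge0// ler1n; apply/card_gt0P; exists point.
(* The summand 1 keeps [q] away from 0 even when the alphabet has one letter and the logarithm
   vanishes. *)
have small eps : 0 < eps -> forall q : R, ln #|A|%:R / eps + 1 <= `|q| ->
    q != 0 /\ ln #|A|%:R / `|q| <= eps.
  move=> eps0 q qe; have q0 : 0 < `|q|.
    by apply: lt_le_trans qe; rewrite ltr_wpDl// divr_ge0// ltW.
  split; first by rewrite -normr_gt0.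
  rewrite ler_pdivrMr// mulrC -ler_pdivrMr//; apply: le_trans qe.
  by rewrite lerDl.
have dims := local_dim_bounds compat PFr lam1 freq recog.
split.
- rewrite aminE; apply/fine_cvgP; split.
    near=> q; have q0 : 0 < q by [].
    by have [] := dist_div_le (lt0r_neq0 q0) lnA0 (tau_max compat PFr lam1 freq
      recog q0).
  apply/cvgrPdist_le => eps eps0; near=> q.
  have q0 : 0 < q by [].
  have [_ H] := dist_div_le (lt0r_neq0 q0) lnA0 (tau_max compat PFr lam1 freq
    recog q0).
  apply: le_trans H _; apply: (proj2 (small _ eps0 q _)).
  by rewrite gtr0_norm.
- rewrite amaxE; apply/fine_cvgP; split.
    near=> q; have q0 : q < 0 by [].
    by have [] := dist_div_le (ltr0_neq0 q0) lnA0 (tau_min compat PFr lam1 freq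
      recog q0).
  apply/cvgrPdist_le => eps eps0; near=> q.
  have q0 : q < 0 by [].
  have [_ H] := dist_div_le (ltr0_neq0 q0) lnA0 (tau_min compat PFr lam1 freq
    recog q0).
  apply: le_trans H _; apply: (proj2 (small _ eps0 q _)).
  by rewrite ltr0_norm// lerNr.
- by move=> x xX; rewrite aminE amaxE; exact: dims.
apply/seteqP; split=> d /=.
  move=> [x xX [lo hi]]; have [] := dims x xX.
  rewrite lo hi -aminE -amaxE => h1 _ h2.
  case: d {lo hi} h1 h2 => [d| |]; last 2 first.
  - by rewrite leye_eq.
  - by rewrite leeNy_eq.
  by rewrite !lee_fin => h1 h2; exists d => //=; rewrite in_itv /= h1.
move=> [s]; rewrite /= in_itv /= => /andP[s1 s2] <-.
have [p p01 ps] : exists2 p : R, 0 <= p <= 1 &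
    s = (1 - p) * alpha_min + p * alpha_max.
  (* When the interval is a single point the quotient that defines [p] would divide by 0. *)
  have [E|ne] := eqVneq alpha_min alpha_max.
    exists 0; first by rewrite lexx ler01.
    by rewrite subr0 mul1r mul0r addr0; apply/eqP; rewrite eq_le s1 {1}E s2.
  have lt : 0 < alpha_max - alpha_min.
    by rewrite subr_gt0 lt_neqAle ne (le_trans s1 s2).
  exists ((s - alpha_min) / (alpha_max - alpha_min)).
    by rewrite divr_ge0 ?subr_ge0//= ?(le_trans s1 s2)// ler_pdivrMr// mul1r
      lerD2r.
  by field; rewrite gt_eqF.
(* [dim_of] is linear in the cost, so the same [p] interpolates between the costs and between the
   dimensions. *)
have [a|x xX xd] := @local_dim_attained _ _ _ _ _ _ compat PFr lam1 freq recog
  (fun a => (1 - p) * cmin P a + p * cmax P a).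
  by have := cmin_le_max P a; nra.
exists x => //; rewrite ps aminE amaxE.
suff <- : dim_of lam r (fun a => (1 - p) * cmin P a + p * cmax P a) =
  (1 - p) * dim_of lam r (cmin P) + p * dim_of lam r (cmax P) by [].
rewrite /dim_of !mulrA -mulrDl !mulr_sumr -big_split /=; congr (_ / _).
by apply: eq_bigr => a _; ring.
Unshelve. all: by end_near. Qed.
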